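(* Let $G\sim G(n,1/2)$ and $d=d(n)=\left\lfloor\frac{7}{32}n-\frac{\sqrt{15n\log n}}{16}\right\rfloor$. Then asymptotically almost surely (i.e. with probability tending to $1$ as $n\to\infty$), $G$ is $d$-rigid.
   Context: $G(n,p)$ is the Erdős–Rényi random graph on $n$ vertices in which each pair of vertices is an edge independently with probability $p$. A graph $G$ is $d$-rigid if some (equivalently every) generic $d$-dimensional bar-and-joint framework $(G,p)$ (with $p:V(G)\to\mathbb{R}^d$ having coordinates algebraically independent over $\mathbb{Q}$) is rigid, i.e. admits no continuous edge-length-preserving motion that changes some pairwise distance between vertices. *)

(* Defs.v *)
From HB Require Import structures.
From mathcomp Require Import all_boot all_order all_algebra.
From mathcomp Require Import mpoly.
From mathcomp Require Import all_classical all_reals all_analysis.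
Set Implicit Arguments.
Unset Strict Implicit.
Unset Printing Implicit Defensive.
Import Order.TTheory GRing.Theory Num.Theory.
Import numFieldNormedType.Exports.
Local Open Scope ring_scope.

Definition pairs (n : nat) : {set {set 'I_n}} := [set e : {set 'I_n} | #|e| == 2%N].

(* A (simple) graph on 'I_n is given by its edge set E, with E \subset pairs n. *)
Definition adj (n : nat) (E : {set {set 'I_n}}) (u v : 'I_n) : bool :=
  [set u; v] \in E.

Definition sqdist (R : realType) (n d : nat) (p : 'I_n -> 'I_d -> R) (u v : 'I_n) : R :=
  \sum_(k < d) (p u k - p v k) ^+ 2.

Definition alg_indep (R : realType) (I : finType) (x : I -> R) : Prop :=
  forall q : mpoly.mpoly #|I| rat, q != 0 ->
    mpoly.mmap (fun c : rat => ratr c) (fun j : 'I_#|I| => x (enum_val j)) q != 0.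

Definition generic (R : realType) (n d : nat) (p : 'I_n -> 'I_d -> R) : Prop :=
  alg_indep (fun ik : 'I_n * 'I_d => p ik.1 ik.2).

Definition nontrivial_flex (R : realType) (n d : nat) (E : {set {set 'I_n}})
  (p : 'I_n -> 'I_d -> R) : Prop :=
  exists P : R -> 'I_n -> 'I_d -> R,
    [/\ (forall u k, ({within `[0%R, 1%R], continuous (fun t => P t u k)})%classic),
        P 0 = p,
        (forall t, t \in `[0, 1] -> forall u v, adj E u v ->
            sqdist (P t) u v = sqdist p u v)
      & exists t, exists u, exists v,
            t \in `[0, 1] /\ sqdist (P t) u v != sqdist p u v].

Definition framework_rigid (R : realType) (n d : nat) (E : {set {set 'I_n}})
  (p : 'I_n -> 'I_d -> R) : Prop :=
  ~ nontrivial_flex E p.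

Definition d_rigid (R : realType) (n d : nat) (E : {set {set 'I_n}}) : Prop :=
  exists p : 'I_n -> 'I_d -> R, generic p /\ framework_rigid E p.

(* G(n,1/2) is the uniform distribution on all 2^(n choose 2) edge sets
   E \subset pairs n.  Probability that G(n,1/2) satisfies P: *)
Definition prob_Gnhalf (R : realType) (n : nat) (P : {set {set 'I_n}} -> Prop) : R :=
  (#|[set E in powerset (pairs n) | `[< P E >] ]|)%:R
  / (#|powerset (pairs n)|)%:R.

(* d(n) = floor(7/32 n - sqrt(15 n log n)/16), truncated at 0 (Num.truncn). *)
Definition dn (R : realType) (n : nat) : nat :=
  Num.truncn ((7%:R / 32%:R) * n%:R - Num.sqrt (15%:R * n%:R * ln (n%:R : R)) / 16%:R : R).

(* Main.v *)
Require Import Defs.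
From HB Require Import structures.
From mathcomp Require Import all_boot all_order all_algebra.
From mathcomp Require Import mpoly.
From mathcomp Require Import all_classical all_reals all_analysis.
From mathcomp Require Import zify ring lra.
Set Implicit Arguments. Unset Strict Implicit. Unset Printing Implicit Defensive.
Import Order.TTheory GRing.Theory Num.Theory.
Import numFieldNormedType.Exports.
Local Open Scope ring_scope.

(** Write [n = 32 m + r] and [d <= 7 m].  Pair vertex [i] with vertex [i + 14 m] for [i < 14 m] and
    place both vertices of a pair at one point, all points being generic.  At such a degenerate
    placement two vertices of a pair with common neighbours at [d] further points have the same
    velocity in every infinitesimal motion; in G(n,1/2) about [14 m * 7/16 + 4 m / 4 > 7 m] points
    carry a common neighbour of a given pair, so the pairs may be contracted.  The contracted
    graph on the [14 m] pairs is dense: each pair is non-adjacent to about [14 m / 16 < m]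
    others.  Keep one pair (the hub) and [13 m - 1] pairs adjacent to it; all other points have [d]
    neighbours among these, so it suffices to treat this core.

    Put the hub at the origin and the other core points at the rows of [P].  For a motion [W]
    fixing the hub, [N = P W^T + W P^T] is symmetric and supported on the non-edges of the core, and
    [X N Y^T = 0] whenever [X P = Y P = 0].  So the core is rigid as soon as some [X], [Y] satisfy
    [X N Y^T <> 0] for all such [N <> 0].  A union bound over the field with two elements produces
    [X], [Y]: a matrix [N] of rank [r] is determined by [r] of its rows, each with few possible
    entries, while [X N Y^T] vanishes with probability about [2^-(3/4 r b)] for [r <= b], where
    [b = 3 m - 1] is the number of rows of [X] and [Y].  The pair [X], [Y] is then lifted to the
    integers.

    Infinitesimal rigidity at one placement passes to algebraically independent ones because the
    relevant minors are rational polynomials, and it implies rigidity along continuous paths by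
    the averaging trick: if [q], [q'] have the same edge lengths then [q' - q] is an infinitesimal
    motion of [q + q']. *)

(** * Counting isotropic pairs over a finite field *)

Lemma card_kermx_le (F : finFieldType) (b k l : nat) (D : 'M[F]_(k, l)) :
  (#|[set Y : 'M[F]_(b, k) | Y *m D == 0%R]| <= #|F| ^ (b * (k - \rank D)))%N.
Proof.
rewrite -mxrank_ker -card_mx.
set f := fun Z : 'M[F]_(b, \rank (kermx D)) => Z *m row_base (kermx D).
rewrite -(card_codom (f := f)); last first.
  by move=> Z Z'; apply: row_free_inj; apply: row_base_free.
apply: subset_leq_card; apply/fintype.subsetP => Y; rewrite inE => /eqP /sub_kermxP.
rewrite -(eq_row_base (kermx D)) => /submxP [Z ->].
exact: codom_f.
Qed.

(** The condition places [x] in the kernel of [C *m cokermx D], whose rank is at least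
    [\rank C - \rank D] by Sylvester's inequality. *)
Lemma card_submx_mul_le (F : finFieldType) (k l i : nat) (C : 'M[F]_(k, l)) (D : 'M[F]_(i, l)) :
  (#|[set x : 'rV_k | (x *m C <= D)%MS]| <= #|F| ^ (k - \rank C + \rank D))%N.
Proof.
have -> : [set x : 'rV_k | (x *m C <= D)%MS] = [set x : 'rV_k | x *m (C *m cokermx D) == 0].
  by apply/setP => x; rewrite !inE mulmxA submxE.
apply: leq_trans (card_kermx_le 1 _) _; rewrite mul1n leq_pexp2l //; first by rewrite -cardsT; apply/card_gt0P; exists 0.
have := mxrank_mul_min C (cokermx D); rewrite mxrank_coker.
move: (rank_leq_col D) (rank_leq_row C) (rank_leq_row (C *m cokermx D)).
set x := \rank (C *m _); set y := \rank C; set z := \rank D; rewrite leq_subLR => *.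
lia.
Qed.

Lemma rank_col_mx_row (F : fieldType) (i l : nat) (x : 'rV[F]_l) (D : 'M[F]_(i, l)) :
  \rank (col_mx x D) = (\rank D + ~~ (x <= D)%MS)%N.
Proof.
rewrite -(addsmxE x D).
have [xD|xD] := boolP (x <= D)%MS.
  by rewrite addn0; apply/eqmx_rank; apply/eqmxP; apply/addsmx_idPr.
rewrite addn1; apply/eqP; rewrite eqn_leq; apply/andP; split.
  apply: leq_trans (mxrank_adds_leqif _ _) _.
  by have := rank_leq_row x; lia.
have : (D < x + D)%MS by rewrite ltmxE addsmxSr /= addsmx_sub submx_refl andbT.
by rewrite ltmxErank => /andP[].
Qed.

(** Expose the rows of [X] one at a time. Exactly [r] of them raise the rank of [X *m C], and these
    are unrestricted. Each other row is mapped into the span of the earlier ones, which leaves at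
    most [#|F| ^ (k - \rank C + r)] choices. The positions of the raising rows give the binomial
    coefficient, through Pascal's rule. *)
Lemma card_rank_mul_le (F : finFieldType) (k l : nat) (C : 'M[F]_(k, l)) (i r : nat) :
  (#|[set X : 'M[F]_(i, k) | \rank (X *m C) == r]| <=
    'C(i, r) * #|F| ^ (k * r + (k - \rank C + r) * (i - r)))%N.
Proof.
have q_gt0 : (0 < #|F|)%N by apply/card_gt0P; exists 0.
elim: i r => [|i IH] r.
  rewrite sub0n muln0 addn0.
  case: r => [|r]; last first.
    by rewrite eq_card0 // => X; rewrite !inE; have := rank_leq_row (X *m C); rewrite leqn0 => /eqP ->.
  by rewrite bin0 muln0 expn0 mul1n; apply: leq_trans (max_card _) _; rewrite card_mx.
pose f (p : 'rV[F]_k * 'M[F]_(i, k)) : 'M[F]_(1 + i, k) := col_mx p.1 p.2.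
pose rk (X : 'M[F]_(i, k)) := \rank (X *m C).
pose S1 := [set p : 'rV[F]_k * 'M[F]_(i, k) | (rk p.2 == r) && (p.1 *m C <= p.2 *m C)%MS].
pose S2 := [set p : 'rV[F]_k * 'M[F]_(i, k) | (r != 0%N) && (rk p.2 == r.-1)].
have le1 : (#|[set X : 'M[F]_(1 + i, k) | \rank (X *m C) == r]| <= #|S1| + #|S2|)%N.
  apply: leq_trans (_ : #|S1 :|: S2| <= _)%N; last by rewrite cardsU leq_subr.
  apply: leq_trans (leq_imset_card f _); apply: subset_leq_card.
  apply/fintype.subsetP => X; rewrite inE => XC; apply/imsetP.
  exists (usubmx X, dsubmx X); last by rewrite /f /= vsubmxK.
  move: XC; rewrite -{1}(vsubmxK X) mul_col_mx rank_col_mx_row !inE /= /rk.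
  by case: (_ <= _)%MS; rewrite /= ?addn0 ?addn1 ?andbT; case: (r) => [|r'] //=; rewrite ?eqSS => ->; rewrite ?orbT.
apply: leq_trans le1 _.
have S1le : (#|S1| <= #|[set X : 'M[F]_(i, k) | rk X == r]| * #|F| ^ (k - \rank C + r))%N.
  rewrite -sum1_card (partition_big (fun p => p.2) (fun X => rk X == r)) /=; last by move=> p; rewrite inE => /andP[].
  rewrite -[X in (_ <= X * _)%N]sum1_card big_distrl /=.
  under [X in (_ <= X)%N]eq_bigl do rewrite inE.
  apply: leq_sum => X /eqP rX; rewrite mul1n -[in X in (_ <= X)%N]rX.
  apply: leq_trans (card_submx_mul_le C (X *m C)).
  rewrite sum1dep_card -(card_in_imset (f := fun p : 'rV[F]_k * 'M[F]_(i, k) => p.1)); last first.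
    by move=> [a b] [c d]; rewrite !inE /= => /andP[_ /eqP->] /andP[_ /eqP ->] ->.
  apply: subset_leq_card; apply/fintype.subsetP => x /imsetP [[a b]].
  by rewrite !inE /= => /andP[/andP[_ aC] /eqP bX] ->; rewrite -bX.
have S2le : (#|S2| <= (r != 0) * (#|[set X : 'M[F]_(i, k) | rk X == r.-1]| * #|F| ^ k))%N.
  have [r0|r0] := eqVneq r 0%N.
    by rewrite mul0n leqn0 cards_eq0; apply/eqP/setP => p; rewrite !inE r0.
  rewrite mul1n mulnC; have -> : S2 = finset.setX finset.setT [set X | rk X == r.-1].
    by apply/setP => -[a b]; rewrite !inE r0.
  by rewrite cardsX cardsT card_mx mul1n.
apply: leq_trans (leq_add S1le S2le) _.
rewrite -/rk in IH.
case: r {S1 S2 S1le S2le} => [|r] /=.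
  rewrite mul0n addn0 (leq_trans (leq_mul (IH _) (leqnn _))) // !bin0 !subn0 !mul1n -expnD leq_pexp2l //; lia.
rewrite mul1n binS mulnDl; apply: leq_add.
  apply: leq_trans (leq_mul (IH _) (leqnn _)) _.
  have [ri|ri] := leqP r.+1 i; last by rewrite bin_small.
  rewrite -mulnA -expnD leq_mul2l leq_pexp2l ?orbT //.
  rewrite -addnA leq_add2l.
  by rewrite subSS -[(i - r)%N]prednK ?subn_gt0 // -subnS mulnS addnC.
apply: leq_trans (leq_mul (IH _) (leqnn _)) _.
rewrite -mulnA -expnD leq_mul2l leq_pexp2l ?orbT // subSS.
rewrite mulnS addnAC [(k + _)%N]addnC leq_add2l leq_mul2r; apply/orP; right; lia.
Qed.

Lemma leq_bin_exp (n r : nat) : ('C(n, r) <= n ^ r)%N.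
Proof.
elim: r n => [|r IH] [|n]; rewrite ?bin0 ?expn0 //.
rewrite -(leq_pmul2l (ltn0Sn r)) -mul_bin_diag.
apply: leq_trans (_ : n.+1 * n ^ r <= _)%N; first by rewrite leq_mul2l IH orbT.
rewrite expnS; apply: leq_trans (leq_pmull _ _) => //.
by rewrite leq_mul2l; case: (r) => [|r1]; rewrite ?expn0 ?leq_exp2r ?leqnSn ?orbT.
Qed.

(** With [rho = r + x], [b = r + y] and [t = minn rho b] the claim reduces to
    [e * t <= x * y + b * r]. The right side is always at least 3/4 of [b * t], with equality at
    [rho = b = 2 * r]; hence the hypothesis on [e]. *)
Lemma isotropic_exponent (k rho b e r : nat) :
  (4 * e <= 3 * b)%N -> (rho <= k)%N -> (r <= minn rho b)%N ->
  (k * r + (k - rho + r) * (b - r) + b * (k - r) + e * minn rho b <= 2 * b * k)%N.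
Proof.
set t := minn rho b => h4 hk hr.
have [tr tb] : (t <= rho)%N /\ (t <= b)%N by rewrite geq_minl geq_minr.
have [x ex] : exists x, rho = (r + x)%N by exists (rho - r)%N; lia.
have [y ey] : exists y, b = (r + y)%N by exists (b - r)%N; lia.
have [z ez] : exists z, k = (rho + z)%N by exists (k - rho)%N; lia.
have [u eu] : exists u, t = (r + u)%N by exists (t - r)%N; lia.
have ux : (u <= x)%N by lia.
have uy : (u <= y)%N by lia.
have key : (e * t <= x * y + b * r)%N.
  have : (4 * e * t <= 3 * b * t)%N by rewrite leq_mul2r h4 orbT.
  move=> {h4}; have : (u * y <= x * y)%N by rewrite leq_mul2r ux orbT.
  suff : (3 * b * t <= 4 * (u * y + b * r))%N by lia.
  rewrite ey eu; suff : (3 * (u * r) + 3 * (r * r) + 3 * (u * y) + 3 * (r * y) <= 4 * (u * y) + 4 * (r * r) + 4 * (r * y))%N by lia.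
  suff: (3 * (u * r) <= u * y + r * r + r * y)%N by lia.
  have : (u * u <= u * y)%N by rewrite leq_mul2l uy orbT.
  have : (r * u <= r * y)%N by rewrite leq_mul2l uy orbT.
  by have := (nat_Cauchy u r).1; rewrite !mulnn; lia.
have -> : (k - rho = z)%N by lia.
have -> : (b - r = y)%N by lia.
have -> : (k - r = x + z)%N by lia.
move: key; rewrite ez ex ey; nia.
Qed.

(** Split by [r = \rank (X *m C)]: given [X], the rows of [Y] range over a space of dimension
    [k - r]. The power of [b.+1] absorbs both the number of values of [r] and the binomial
    coefficients. *)
Lemma card_isotropic_pairs (F : finFieldType) (k b e : nat) (C : 'M[F]_k) :
  (4 * e <= 3 * b)%N ->
  (#|[set p : 'M[F]_(b, k) * 'M[F]_(b, k) | p.1 *m C *m p.2^T == 0%R]|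
     * #|F| ^ (e * minn (\rank C) b)
   <= b.+1 ^ (minn (\rank C) b).+1 * #|F| ^ (2 * b * k))%N.
Proof.
set q := #|F|; set rho := \rank C; set t := minn rho b => h4.
have q_gt0 : (0 < q)%N by apply/card_gt0P; exists 0.
set S := [set p | _].
have cS : (#|S| <= \sum_(r < t.+1)
   'C(b, r) * q ^ (k * r + (k - rho + r) * (b - r)) * q ^ (b * (k - r)))%N.
  have rkP (p : 'M[F]_(b, k) * 'M[F]_(b, k)) : (\rank (p.1 *m C) < t.+1)%N.
    by rewrite ltnS leq_min rank_leq_row andbT mxrankM_maxr.
  rewrite -sum1_card (partition_big (fun p => Ordinal (rkP p)) xpredT) //=.
  apply: leq_sum => r _.
  pose Xr := [set X : 'M[F]_(b, k) | \rank (X *m C) == r].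
  apply: leq_trans (leq_mul (card_rank_mul_le C b r) (leqnn _)).
  rewrite sum1dep_card -sum1_card (partition_big (fun p => p.1) (fun X => X \in Xr)) /=; last first.
    by move=> p; rewrite !inE => /andP[_]; rewrite -val_eqE.
  rewrite -[X in (_ <= X * _)%N]sum1_card big_distrl /=.
  apply: leq_sum => X; rewrite inE => /eqP rX; rewrite mul1n.
  rewrite -[in X in (_ <= X)%N]rX -mxrank_tr.
  apply: leq_trans (card_kermx_le b (X *m C)^T).
  rewrite sum1dep_card -(card_in_imset (f := fun p : 'M[F]_(b, k) * 'M[F]_(b, k) => p.2)); last first.
    by move=> [a c] [a' c']; rewrite !inE /= => /andP[_ /eqP ->] /andP[_ /eqP ->] ->.
  apply: subset_leq_card; apply/fintype.subsetP => Y /imsetP [[a c]].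
  rewrite !inE /= => /andP[/andP[/eqP h _] /eqP aX] ->.
  by rewrite -[c]trmxK -trmx_mul -aX h trmx0.
apply: leq_trans (leq_mul cS (leqnn _)) _.
rewrite big_distrl /=.
apply: leq_trans (_ : \sum_(r < t.+1) b.+1 ^ t * q ^ (2 * b * k) <= _)%N.
  apply: leq_sum => r _; have rt : (r <= t)%N by rewrite -ltnS.
  rewrite -!mulnA -!expnD; apply: leq_mul; last first.
    rewrite leq_pexp2l // addnA [(2 * (b * k))%N]mulnA; apply: isotropic_exponent => //.
    exact: rank_leq_row.
  apply: leq_trans (leq_bin_exp _ _) _.
  apply: leq_trans (_ : b.+1 ^ r <= _)%N; last by rewrite leq_pexp2l.
  by case: (nat_of_ord r) => // r'; rewrite leq_exp2r.
rewrite sum_nat_const card_ord mulnA leq_mul2r expnS leq_mul2r ltnS geq_minr !orbT //.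

Qed.

(** * Symmetric matrices with prescribed support *)

Definition supp_sym (F : nzRingType) (k : nat) (H : rel 'I_k) (C : 'M[F]_k) :=
  (C^T == C) && [forall u, forall v, ~~ H u v ==> (C u v == 0)].

Lemma supp_symP (F : nzRingType) (k : nat) (H : rel 'I_k) (C : 'M[F]_k) :
  reflect (C^T = C /\ forall u v, ~~ H u v -> C u v = 0) (supp_sym H C).
Proof.
apply: (iffP andP) => -[h1 h2]; split.
- exact/eqP.
- by move=> u v huv; apply/eqP; move/forallP/(_ u)/forallP/(_ v)/implyP: h2; apply.
- exact/eqP.
- by apply/forallP => u; apply/forallP => v; apply/implyP => /h2 ->.
Qed.

(* By symmetry the rows [I] also give the columns [I], which fix the coefficients of every other
   row in the basis [rowsub I C]. *)
Lemma sym_eq_of_rows (F : fieldType) (k r : nat) (C C' : 'M[F]_k) (I : 'I_r -> 'I_k) :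
  C^T = C -> C'^T = C' -> \rank C = r -> \rank C' = r ->
  row_free (rowsub I C) -> rowsub I C = rowsub I C' -> C = C'.
Proof.
move=> sC sC' rC rC' frC eR.
pose E : 'M[F]_(r, k) := rowsub I 1%:M.
have eC : rowsub I C = E *m C by rewrite rowsubE.
have eC' : rowsub I C = E *m C' by rewrite eR rowsubE.
set R := rowsub I C in frC eR eC eC' *.
have gen (A : 'M[F]_k) : \rank A = r -> R = E *m A -> exists M, A = M *m R.
  move=> rA eA; suff /submxP [M ->] : (A <= R)%MS by exists M.
  rewrite -(geq_leqif (mxrank_leqif_sup _)); last by rewrite eA submxMl.
  by move/eqP: frC => ->; rewrite rA.
have [M eM] := gen _ rC eC; have [M' eM'] := gen _ rC' eC'.
have h : M *m (R *m E^T) = R^T by rewrite mulmxA -eM eC trmx_mul sC.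
have h' : M' *m (R *m E^T) = R^T by rewrite mulmxA -eM' eC' trmx_mul sC'.
have fS : row_free (R *m E^T).
  rewrite /row_free eqn_leq rank_leq_row; apply: leq_trans (_ : \rank R^T <= _)%N.
    by rewrite mxrank_tr; move/eqP: frC => ->.
  by rewrite -h mxrankM_maxr.
by rewrite eM eM'; congr (_ *m _); apply: (row_free_inj fS); rewrite h h'.
Qed.

(** Encode [C] by the indices of [r] independent rows and their entries on at most [D] supported
    columns each; [sym_eq_of_rows] makes this injective. *)
Lemma card_supp_sym_rank (F : finFieldType) (k D r : nat) (H : rel 'I_k) :
  (forall u, #|[set v | H u v]| <= D)%N ->
  (#|[set C : 'M[F]_k | supp_sym H C && (\rank C == r)]| <= (k * #|F| ^ D) ^ r)%N.
Proof.
move=> degH.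
pose P := [set p : {ffun 'I_r -> 'I_k} * 'M[F]_k |
   [&& supp_sym H p.2, \rank p.2 == r & row_free (rowsub p.1 p.2)]].
apply: leq_trans (_ : #|P| <= _)%N.
  apply: leq_trans (leq_imset_card (fun p => p.2) P); apply: subset_leq_card.
  apply/fintype.subsetP => C; rewrite inE => /andP[sC /eqP rC]; apply/imsetP.
  have hI : exists I : {ffun 'I_r -> 'I_k}, row_free (rowsub I C).
    by case: r / rC {P}; exists (maxrankfun C); exact: maxrowsub_free.
  by have [I fI] := hI; exists (I, C) => //; rewrite inE /= sC rC eqxx fI.
(* Rows with fewer than [D] supported columns are padded through the default of [nth]. *)
pose enc (p : {ffun 'I_r -> 'I_k} * 'M[F]_k) : {ffun 'I_r -> 'I_k} * 'M[F]_(r, D) :=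
  (p.1, \matrix_(j, t) p.2 (p.1 j) (nth (p.1 j) (enum [set v | H (p.1 j) v]) t)).
rewrite -(card_in_imset (f := enc)).
  apply: leq_trans (max_card _) _.
  by rewrite card_prod card_ffun !card_ord card_mx expnMn -expnM mulnC [(r * D)%N]mulnC mulnC.
move=> [I C] [I' C']; rewrite !inE /=.
move=> /and3P[/supp_symP[sC zC] /eqP rC fC] /and3P[/supp_symP[sC' zC'] /eqP rC' _].
rewrite /enc /= => -[eI]; rewrite -{I'}eI => /matrixP e.
congr (_, _); apply: sym_eq_of_rows rC rC' fC _ => //.
apply/matrixP => j v; rewrite !mxE.
have [Hv|nHv] := boolP (H (I j) v); last by rewrite zC ?zC'.
have vin : v \in enum [set v | H (I j) v] by rewrite mem_enum inE.
have vlt : (index v (enum [set v | H (I j) v]) < D)%N.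
  by apply: leq_trans (degH (I j)); rewrite cardE index_mem.
by have := e j (Ordinal vlt); rewrite !mxE /= nth_index.
Qed.

(** The supported entries above the diagonal determine [C], and they are at most half of the [k * D]
    supported positions. This count serves for ranks from [b] on, where the gain in
    [card_isotropic_pairs] stops growing with the rank. *)
Lemma card_supp_sym (F : finFieldType) (k D M : nat) (H : rel 'I_k) :
  ssrbool.symmetric H -> irreflexive H ->
  (forall u, #|[set v | H u v]| <= D)%N -> (k * D <= M.*2.+1)%N ->
  (#|[set C : 'M[F]_k | supp_sym H C]| <= #|F| ^ M)%N.
Proof.
move=> symH irrH degH kD.
have q_gt0 : (0 < #|F|)%N by apply/card_gt0P; exists 0.
pose U := [set p : 'I_k * 'I_k | (p.1 < p.2)%N && H p.1 p.2].
have cU : (#|U| <= M)%N.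
  pose A := [set p : 'I_k * 'I_k | H p.1 p.2].
  have cA : (#|A| <= k * D)%N.
    rewrite -sum1_card (partition_big (fun p => p.1) xpredT) //=.
    rewrite -[k in X in (_ <= X)%N]card_ord -sum_nat_const; apply: leq_sum => u _.
    apply: leq_trans (degH u); rewrite sum1dep_card.
    rewrite -(card_in_imset (f := fun p : 'I_k * 'I_k => p.2)); last first.
      by move=> [a c] [a' c']; rewrite !inE /= => /andP[_ /eqP ->] /andP[_ /eqP ->] ->.
    apply: subset_leq_card; apply/fintype.subsetP => v /imsetP [[a c]].
    by rewrite !inE /= => /andP[h /eqP <-] ->.
  pose V := [set (p.2, p.1) | p in U].
  have cV : #|V| = #|U| by rewrite card_imset // => -[a c] [a' c'] [-> ->].
  have dUV : [disjoint U & V].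
    apply/pred0P => -[a c] /=; apply/negP => /andP[]; rewrite inE /= => /andP[ac _].
    by move=> /imsetP [[a' c']]; rewrite inE /= => /andP[h _] [e1 e2]; move: ac; rewrite e1 e2; lia.
  have : (#|U :|: V| <= #|A|)%N.
    apply: subset_leq_card; apply/fintype.subsetP => -[a c]; rewrite !inE /=.
    by case/orP => [/andP[]//|/imsetP[[a' c']]]; rewrite inE /= => /andP[_ h] [-> ->]; rewrite symH.
  by rewrite cardsU (disjoint_setI0 dUV) cards0 subn0 cV; lia.
apply: leq_trans (_ : #|F| ^ #|U| <= _)%N; last by rewrite leq_pexp2l.
have <- : #|pffun_on (0 : F) (mem U) predT| = (#|F| ^ #|U|)%N by rewrite card_pffun_on.
pose enc (C : 'M[F]_k) := [ffun p : 'I_k * 'I_k => if p \in U then C p.1 p.2 else 0].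
rewrite -(card_in_imset (f := enc)).
  apply: subset_leq_card; apply/fintype.subsetP => f /imsetP [C _ ->].
  apply/pffun_onP; split; last by [].
  by apply/supportP => p /negbTE; rewrite /enc ffunE => ->.
move=> C C'; rewrite !inE => /supp_symP[sC zC] /supp_symP[sC' zC'] /ffunP e.
have lt (u v : 'I_k) : (u < v)%N -> C u v = C' u v.
  move=> uv; have [huv|huv] := boolP (H u v); last by rewrite zC ?zC'.
  by have := e (u, v); rewrite !ffunE inE /= uv huv.
apply/matrixP => u v; case: (ltngtP u v) => [||uv]; first exact: lt.
  by move=> vu; rewrite -sC -sC' !mxE lt.
by rewrite zC ?zC' // (val_inj uv) irrH.
Qed.

(** Union bound over the nonzero [C], grouped by [minn (\rank C) b]. Each of the [b] groups spoils
    at most a fraction [1 / b.+1] of all pairs, so some pair survives. *)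
Lemma exists_nonisotropic (F : finFieldType) (k D M b e : nat) (H : rel 'I_k) :
  ssrbool.symmetric H -> irreflexive H ->
  (forall u, #|[set v | H u v]| <= D)%N -> (k * D <= M.*2.+1)%N ->
  (0 < b)%N -> (4 * e <= 3 * b)%N ->
  (b.+1 * (k * #|F| ^ D * b.+1 ^ 2) <= #|F| ^ e)%N ->
  (b.+1 * (#|F| ^ M * b.+1 ^ b.+1) <= #|F| ^ (e * b))%N ->
  exists X Y : 'M[F]_(b, k), forall C, supp_sym H C -> X *m C *m Y^T = 0 -> C = 0.
Proof.
move=> symH irrH degH kD b_gt0 h4 h1 h2.
set q := #|F| in h1 h2 *.
have q_gt0 : (0 < q)%N by apply/card_gt0P; exists 0.
pose N (C : 'M[F]_k) := [set p : 'M[F]_(b, k) * 'M[F]_(b, k) | p.1 *m C *m p.2^T == 0%R].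
pose Q := (q ^ (2 * b * k))%N.
have Q_gt0 : (0 < Q)%N by rewrite expn_gt0 q_gt0.
pose T := [set C : 'M[F]_k | supp_sym H C && (C != 0)].
pose cls (C : 'M[F]_k) := minn (\rank C) b.
have clsN t : (0 < t <= b)%N -> (b.+1 * \sum_(C in T | cls C == t) #|N C| <= Q)%N.
  move=> /andP[t_gt0 tb].
  have qt : (0 < q ^ (e * t))%N by rewrite expn_gt0 q_gt0.
  have NC C : cls C == t -> (#|N C| * q ^ (e * t) <= b.+1 ^ t.+1 * Q)%N.
    by move=> /eqP <-; apply: card_isotropic_pairs.
  rewrite -(leq_pmul2r qt) -mulnA big_distrl /=.
  apply: leq_trans (_ : b.+1 * \sum_(C in T | cls C == t) b.+1 ^ t.+1 * Q <= _)%N.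
    by rewrite leq_mul2l; apply/orP; right; apply: leq_sum => C /andP[_]; apply: NC.
  rewrite sum_nat_cond_const; set cT := #|_|.
  rewrite [X in (_ <= X)%N]mulnC !mulnA leq_mul2r; apply/orP; right.
  (* For [t < b] the group has rank exactly [t] and is counted through rows; the group [t = b]
     collects all larger ranks and is counted through the whole support. *)
  have [tltb|] := ltnP t b; last first.
    move=> bt; have {tb bt} et : t = b by apply/eqP; rewrite eqn_leq tb bt.
    rewrite et; apply: leq_trans h2; rewrite -mulnA !leq_mul2l; apply/orP; right.
    rewrite leq_mul2r; apply/orP; right.
    apply: leq_trans (card_supp_sym F symH irrH degH kD).
    by apply: subset_leq_card; apply/fintype.subsetP => C; rewrite !inE => /andP[/andP[]].
  have cTle : (cT <= (k * q ^ D) ^ t)%N.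
    apply: leq_trans (card_supp_sym_rank F t degH).
    apply: subset_leq_card; apply/fintype.subsetP => C; rewrite !inE /cls => /andP[/andP[-> _] /eqP h] /=.
    by apply/eqP; move: h tltb; rewrite /minn; case: ltnP => // _ ->; rewrite ltnn.
  apply: leq_trans (_ : (b.+1 * (k * q ^ D * b.+1 ^ 2)) ^ t <= _)%N; last first.
    by rewrite expnM leq_exp2r.
  rewrite expnMn -mulnA; apply: leq_mul; first by rewrite -{1}[b.+1]expn1 leq_pexp2l.
  rewrite [((_ * _) ^ t)%N]expnMn -expnM; apply: leq_mul => //; rewrite leq_pexp2l //; lia.
have total : (\sum_(C in T) #|N C| < Q)%N.
  have rk C : C \in T -> (0 < cls C <= b)%N.
    rewrite inE => /andP[_ C0]; rewrite /cls geq_minr andbT leq_min b_gt0 andbT.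
    by rewrite lt0n mxrank_eq0.
  rewrite (partition_big (fun C => inord (cls C) : 'I_b.+1) (fun t => (0 < t)%N)) /=; last first.
    by move=> C /rk /andP[c1 c2]; rewrite inordK // ltnS.
  rewrite -(ltn_pmul2l (ltn0Sn b)) big_distrr /=.
  apply: leq_ltn_trans (_ : \sum_(t < b.+1 | (0 < t)%N) Q < _)%N.
    apply: leq_sum => t t_gt0.
    apply: leq_trans (_ : b.+1 * \sum_(C in T | cls C == t) #|N C| <= _)%N; last first.
      by apply: clsN; rewrite t_gt0 -ltnS /=.
    rewrite leq_mul2l; apply/orP; right; apply: eq_leq; apply: eq_bigl => C.
    case CT: (C \in T) => //=; have := rk C CT => h.
    by rewrite -val_eqE /= inordK // ltnS; case/andP: h.
  by rewrite big_mkcond big_ord_recl /= add0n sum_nat_const card_ord ltn_pmul2r.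
have : (#|\bigcup_(C in T) N C| < #|{: 'M[F]_(b, k) * 'M[F]_(b, k)}|)%N.
  rewrite card_prod card_mx -expnD.
  have -> : (b * k + b * k = 2 * b * k)%N by lia.
  apply: leq_ltn_trans total.
  elim/big_rec2: _ => [|C S s _ IH]; first by rewrite cards0.
  by apply: leq_trans (leq_card_setU _ _) _; rewrite leq_add2l.
move=> hlt; have [[X Y] hXY] : exists p, p \notin \bigcup_(C in T) N C.
  apply/existsP; apply: contraLR hlt; rewrite negb_exists -leqNgt => /forallP h.
  by rewrite -cardsT; apply: subset_leq_card; apply/fintype.subsetP => p _; have := h p; rewrite negbK.
exists X, Y => C sC hC; apply: contraNeq hXY => C0.
by apply/bigcupP; exists C; rewrite !inE ?sC //= hC.
Qed.

(** * Infinitesimal rigidity *)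

(** Half the derivative of the squared edge lengths at [q] in direction [w], indexed by ordered
    pairs. The ring is general so that [q] can have polynomial entries. *)
Definition mot (S : comNzRingType) (n d : nat) (a : rel 'I_n) (q w : 'M[S]_(n, d)) : 'M[S]_n :=
  \matrix_(u, v) ((a u v)%:R * \sum_c (q u c - q v c) * (w u c - w v c)).

Lemma mot_is_linear (S : comNzRingType) (n d : nat) (a : rel 'I_n) (q : 'M[S]_(n, d)) :
  linear (mot a q).
Proof.
move=> x w w'; apply/matrixP => u v; rewrite !mxE mulrCA -mulrDr; congr (_ * _).
by rewrite mulr_sumr -big_split; apply: eq_bigr => c _; rewrite !mxE /=; ring.
Qed.

HB.instance Definition _ (S : comNzRingType) (n d : nat) (a : rel 'I_n) (q : 'M[S]_(n, d)) :=
  GRing.isLinear.Build S 'M[S]_(n, d) 'M[S]_n _ (mot a q) (mot_is_linear a q).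

(** The transpose of the usual rigidity matrix: velocities are row vectors, so the infinitesimal
    motions form its [kermx]. *)
Definition rigmx (S : comNzRingType) (n d : nat) (a : rel 'I_n) (q : 'M[S]_(n, d)) :
  'M[S]_(n * d, n * n) := lin_mx (mot a q).

Lemma map_rigmx (S T : comNzRingType) (f : {rmorphism S -> T}) (n d : nat) (a : rel 'I_n)
    (q : 'M[S]_(n, d)) :
  map_mx f (rigmx a q) = rigmx a (map_mx f q).
Proof.
apply: map_lin_mx => w; apply/matrixP => u v; rewrite !mxE rmorphM rmorph_nat rmorph_sum.
by congr (_ * _); apply: eq_bigr => c _; rewrite !mxE rmorphM !rmorphB.
Qed.

(** Homogeneous coordinates: [row_full (affmx q)] says that the points affinely span the space. *)
Definition affmx (S : comNzRingType) (n d : nat) (q : 'M[S]_(n, d)) : 'M[S]_(n, 1 + d) :=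
  row_mx (const_mx 1) q.

(* The infinitesimal isometry [x |-> t + x (A - A^T)] is encoded by the unconstrained matrix
   [col_mx t A]. *)
Definition skewpart (S : comNzRingType) (d : nat) (B : 'M[S]_(1 + d, d)) : 'M[S]_(1 + d, d) :=
  col_mx (usubmx B) (dsubmx B - (dsubmx B)^T).

Lemma skewpart_is_linear (S : comNzRingType) (d : nat) : linear (@skewpart S d).
Proof.
move=> x A B; rewrite /skewpart scale_col_mx add_col_mx; congr col_mx.
  by apply/matrixP => i j; rewrite !mxE.
by apply/matrixP => i j; rewrite !mxE; ring.
Qed.

HB.instance Definition _ (S : comNzRingType) (d : nat) :=
  GRing.isLinear.Build S 'M[S]_(1 + d, d) 'M[S]_(1 + d, d) _ (@skewpart S d)
    (@skewpart_is_linear S d).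

Definition trivmx (S : comNzRingType) (n d : nat) (q : 'M[S]_(n, d)) :
  'M[S]_((1 + d) * d, n * d) := lin_mx (@skewpart S d) *m lin_mx (mulmx (affmx q)).

Lemma mul_trivmx (S : comNzRingType) (n d : nat) (q : 'M[S]_(n, d)) (B : 'M[S]_(1 + d, d)) :
  mxvec B *m trivmx q = mxvec (affmx q *m skewpart B).
Proof. by rewrite mulmxA !mul_vec_lin. Qed.

(** Two points at difference [x] have velocity difference [x *m (A - A^T)], which is orthogonal to
    [x] by skew-symmetry. *)
Lemma mot_skewpart (S : comNzRingType) (n d : nat) (a : rel 'I_n) (q : 'M[S]_(n, d))
    (B : 'M[S]_(1 + d, d)) :
  mot a q (affmx q *m skewpart B) = 0.
Proof.
pose A := dsubmx B.
have diff u v c : (affmx q *m skewpart B) u c - (affmx q *m skewpart B) v c =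
    \sum_e (q u e - q v e) * (A e c - A c e).
  rewrite /affmx /skewpart mul_row_col !mxE !big_ord1 !mxE opprD addrACA subrr add0r -sumrB.
  by apply: eq_bigr => e _; rewrite -mulrBl !mxE.
apply/matrixP => u v; rewrite !mxE; under eq_bigr do rewrite diff.
under eq_bigr do rewrite mulr_sumr; rewrite -[RHS](mulr0 (a u v)%:R); congr (_ * _).
pose F c e := (q u c - q v c) * ((q u e - q v e) * A e c).
rewrite (_ : \sum_c _ = \sum_c \sum_e F c e - \sum_c \sum_e F e c).
  by rewrite [X in _ - X]exchange_big subrr.
rewrite -sumrB; apply: eq_bigr => c _; rewrite -sumrB; apply: eq_bigr => e _.
by rewrite /F; ring.
Qed.

Lemma row_free_lin_mx (F : fieldType) (m1 n1 m2 n2 : nat)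
    (f : {linear 'M[F]_(m1, n1) -> 'M[F]_(m2, n2)}) :
  (forall A, f A = 0 -> A = 0) <-> row_free (lin_mx f).
Proof.
split=> [f0|fr A fA]; last first.
  apply: (can_inj mxvecK); apply: (row_free_inj fr).
  by rewrite mul_vec_lin fA !linear0 mul0mx.
rewrite -kermx_eq0; apply/eqP/row_matrixP => i; rewrite row0.
suff /f0 v0 : f (vec_mx (row i (kermx (lin_mx f)))) = 0.
  by rewrite -[row i (kermx (lin_mx f))]vec_mxK v0 linear0.
apply: (can_inj mxvecK).
by rewrite -mul_vec_lin vec_mxK -row_mul mulmx_ker row0 linear0.
Qed.

(* This is [d (d + 1) / 2], but the value is never needed. *)
Definition dimtriv (F : fieldType) (d : nat) : nat := \rank (lin_mx (@skewpart F d)).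

Lemma rank_trivmx (F : fieldType) (n d : nat) (q : 'M[F]_(n, d)) :
  row_full (affmx q) -> \rank (trivmx q) = dimtriv F d.
Proof.
move=> /row_fullP [L LH]; rewrite /trivmx mxrankMfree //.
apply/row_free_lin_mx => A /(congr1 (mulmx L)).
by rewrite mulmxA LH mul1mx mulmx0.
Qed.

Lemma trivmx_rigmx (F : fieldType) (n d : nat) (a : rel 'I_n) (q : 'M[F]_(n, d)) :
  trivmx q *m rigmx a q = 0.
Proof.
apply/row_matrixP => i; rewrite row_mul rowE -[delta_mx _ _]vec_mxK mul_trivmx.
by rewrite mul_vec_lin /= mot_skewpart row0 linear0.
Qed.

(** By [trivmx_rigmx] the trivial motions always lie in the kernel, so the inequality says that
    there are no others. The formulation by ranks suits both semicontinuity and the specialisation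
    of minors. *)
Definition inf_rigid (F : fieldType) (n d : nat) (a : rel 'I_n) (q : 'M[F]_(n, d)) : bool :=
  row_full (affmx q) && (n * d <= \rank (rigmx a q) + dimtriv F d)%N.

Lemma inf_rigid_motion (F : fieldType) (n d : nat) (a : rel 'I_n) (q w : 'M[F]_(n, d)) :
  inf_rigid a q -> mot a q w = 0 -> exists B, w = affmx q *m skewpart B.
Proof.
move=> /andP[fq rq] mw.
have tk : (trivmx q <= kermx (rigmx a q))%MS by apply/sub_kermxP/trivmx_rigmx.
have kt : (kermx (rigmx a q) <= trivmx q)%MS.
  by rewrite -(geq_leqif (mxrank_leqif_sup tk)) rank_trivmx // mxrank_ker leq_subLR.
have /submxP [x ex] : (mxvec w <= trivmx q)%MS.
  by apply: submx_trans kt; apply/sub_kermxP; rewrite mul_vec_lin /= mw linear0.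
exists (vec_mx x); apply: (can_inj mxvecK); rewrite -mul_trivmx vec_mxK; exact: ex.
Qed.

Lemma inf_rigidI (F : fieldType) (n d : nat) (a : rel 'I_n) (q : 'M[F]_(n, d)) :
  row_full (affmx q) ->
  (forall w, mot a q w = 0 -> exists B, w = affmx q *m skewpart B) -> inf_rigid a q.
Proof.
move=> fq hq; rewrite /inf_rigid fq /=.
suff kt : (kermx (rigmx a q) <= trivmx q)%MS.
  by have := mxrankS kt; rewrite rank_trivmx // mxrank_ker leq_subLR.
apply/row_subP => i; set x := row i _.
have [|B eB] := hq (vec_mx x).
  apply: (can_inj mxvecK); rewrite -mul_vec_lin vec_mxK linear0.
  by rewrite -row_mul mulmx_ker row0.
by rewrite -[x]vec_mxK eB -mul_trivmx submxMl.
Qed.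

Lemma skewpart_of_skew (R : numFieldType) (d : nat) (t : 'rV[R]_d) (S : 'M[R]_d) :
  S^T = - S -> skewpart (col_mx t (2%:R^-1 *: S)) = col_mx t S.
Proof.
move=> sS; rewrite /skewpart col_mxKu col_mxKd; congr col_mx.
apply/matrixP => i j; move/matrixP: sS => /(_ i j); rewrite !mxE => ->.
by field.
Qed.

(** * Lifting from the field with two elements to characteristic 0 *)

Definition lift_F2 (m n : nat) (A : 'M['F_2]_(m, n)) : 'M[int]_(m, n) :=
  map_mx (fun x : 'F_2 => (x : nat)%:Z) A.

Lemma lift_F2K (m n : nat) (A : 'M['F_2]_(m, n)) : map_mx intr (lift_F2 A) = A.
Proof. by apply/matrixP => i j; rewrite !mxE -pmulrn natr_Zp. Qed.

(** A right inverse modulo 2 lifts to an integer matrix whose product with [A] has odd determinant,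
    hence a nonzero one. *)
Lemma row_free_mod2 (R : numFieldType) (m n : nat) (A : 'M[int]_(m, n)) :
  row_free (map_mx (intr : int -> 'F_2) A) -> row_free (map_mx (intr : int -> R) A).
Proof.
move=> /row_freeP [B AB].
pose D := A *m lift_F2 B.
have dD : \det D != 0.
  apply/eqP => /(congr1 (intr : int -> 'F_2)).
  rewrite -det_map_mx map_mxM lift_F2K AB det1 => /eqP.
  by rewrite mulr0z oner_eq0.
have : \rank (map_mx (intr : int -> R) D) = m.
  by apply/mxrank_unit; rewrite unitmxE det_map_mx unitfE intr_eq0.
rewrite map_mxM /row_free => rD.
by rewrite eqn_leq rank_leq_row -{1}rD mxrankM_maxl.
Qed.

Definition asym (S : comNzRingType) (k : nat) (C : 'M[S]_k) := C^T - C.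
Definition offsupp (S : comNzRingType) (k : nat) (H : rel 'I_k) (C : 'M[S]_k) :=
  \matrix_(u, v) ((~~ H u v)%:R * C u v).
Definition congr_mx (S : comNzRingType) (b k : nat) (X Y : 'M[S]_(b, k)) (C : 'M[S]_k) :=
  X *m C *m Y^T.

Lemma asym_is_linear (S : comNzRingType) (k : nat) : linear (@asym S k).
Proof. by move=> x A B; apply/matrixP => i j; rewrite !mxE; ring. Qed.
Lemma offsupp_is_linear (S : comNzRingType) (k : nat) (H : rel 'I_k) : linear (@offsupp S k H).
Proof. by move=> x A B; apply/matrixP => i j; rewrite !mxE; ring. Qed.
Lemma congr_mx_is_linear (S : comNzRingType) (b k : nat) (X Y : 'M[S]_(b, k)) :
  linear (congr_mx X Y).
Proof. by move=> x A B; rewrite /congr_mx mulmxDr -scalemxAr mulmxDl -scalemxAl. Qed.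

HB.instance Definition _ (S : comNzRingType) (k : nat) :=
  GRing.isLinear.Build S 'M[S]_k 'M[S]_k _ (@asym S k) (@asym_is_linear S k).
HB.instance Definition _ (S : comNzRingType) (k : nat) (H : rel 'I_k) :=
  GRing.isLinear.Build S 'M[S]_k 'M[S]_k _ (@offsupp S k H) (@offsupp_is_linear S k H).
HB.instance Definition _ (S : comNzRingType) (b k : nat) (X Y : 'M[S]_(b, k)) :=
  GRing.isLinear.Build S 'M[S]_k 'M[S]_b _ (congr_mx X Y) (congr_mx_is_linear X Y).

(* The system [C^T = C], [C] vanishes off [H], [X C Y^T = 0] in the entries of [C]; its coefficients
   are integers when those of [X] and [Y] are, so injectivity modulo 2 lifts to characteristic 0. *)
Definition isosys (S : comNzRingType) (b k : nat) (H : rel 'I_k) (X Y : 'M[S]_(b, k)) :=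
  row_mx (lin_mx (@asym S k)) (row_mx (lin_mx (@offsupp S k H)) (lin_mx (congr_mx X Y))).

Lemma map_isosys (S T : comNzRingType) (f : {rmorphism S -> T}) (b k : nat) (H : rel 'I_k)
    (X Y : 'M[S]_(b, k)) :
  map_mx f (isosys H X Y) = isosys H (map_mx f X) (map_mx f Y).
Proof.
rewrite /isosys !map_row_mx; congr row_mx; last congr row_mx; apply: map_lin_mx => C.
- by apply/matrixP => i j; rewrite !mxE rmorphB.
- by apply/matrixP => i j; rewrite !mxE rmorphM rmorph_nat.
- by rewrite /congr_mx !map_mxM map_trmx.
Qed.

Lemma isosysP (F : fieldType) (b k : nat) (H : rel 'I_k) (X Y : 'M[F]_(b, k)) :
  (forall C, supp_sym H C -> X *m C *m Y^T = 0 -> C = 0) <-> row_free (isosys H X Y).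
Proof.
have eqC (C : 'M[F]_k) : (mxvec C *m isosys H X Y = 0) <-> (supp_sym H C /\ X *m C *m Y^T = 0).
  rewrite /isosys !mul_mx_row !mul_vec_lin /=; split.
    move/eqP; rewrite !row_mx_eq0 !mxvec_eq0 => /and3P[/eqP h1 /eqP h2 /eqP h3].
    split=> //; apply/supp_symP; split; first by apply/eqP; rewrite -subr_eq0; apply/eqP.
    by move=> u v Huv; move/matrixP: h2 => /(_ u v); rewrite !mxE Huv mul1r.
  move=> [/supp_symP [h1 h2] h3]; rewrite /asym h1 subrr /congr_mx h3.
  suff -> : offsupp H C = 0 by rewrite !linear0 !row_mx0.
  apply/matrixP => u v; rewrite !mxE; case: (boolP (H u v)) => /= [_|/h2 ->]; first by rewrite mul0r.
  by rewrite mulr0.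
split=> [h|fr C sC hC].
  apply: inj_row_free => v; rewrite -[v]vec_mxK => /eqC [h1 h2].
  by rewrite (h _ h1 h2) linear0.
apply: (can_inj mxvecK); apply: (row_free_inj fr); rewrite linear0 mul0mx.
exact/eqC.
Qed.

Lemma lift_nonisotropic (R : numFieldType) (b k : nat) (H : rel 'I_k) (X Y : 'M['F_2]_(b, k)) :
  (forall C, supp_sym H C -> X *m C *m Y^T = 0 -> C = 0) ->
  exists X' Y' : 'M[R]_(b, k), forall C, supp_sym H C -> X' *m C *m Y'^T = 0 -> C = 0.
Proof.
move/isosysP; rewrite -[X]lift_F2K -[Y]lift_F2K -map_isosys => /(@row_free_mod2 R).
by rewrite map_isosys => /isosysP h; exists (map_mx intr (lift_F2 X)), (map_mx intr (lift_F2 Y)).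
Qed.

(** * Rigidity of a cone *)

Lemma row_free_left_annihilator (F : fieldType) (k s d : nat) (G : 'M[F]_(k, s)) :
  (d + s <= k)%N -> exists P : 'M[F]_(d, k), row_free P /\ P *m G = 0.
Proof.
move=> dsk; pose K := row_base (kermx G).
have dK : (d <= \rank (kermx G))%N by rewrite mxrank_ker; have := rank_leq_col G; lia.
exists (pid_mx d *m K); split.
  by rewrite /row_free mxrankMfree ?row_base_free // rank_pid_mx.
suff KG : K *m G = 0 by rewrite -mulmxA KG mulmx0.
by apply/sub_kermxP; rewrite /K eq_row_base.
Qed.

(** Both terms of [P *m W^T + W *m P^T] die between [X] and [Y^T], so the sum is 0. Then [P *m W^T]
    is skew-symmetric, and cancelling [P] with its left inverse [L] gives [W = P *m S] for the skew
    matrix [S = L *m W]. *)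
Lemma coned_motion_trivial (R : numFieldType) (b k d : nat) (H : rel 'I_k) (X Y : 'M[R]_(b, k))
    (P W : 'M[R]_(k, d)) (L : 'M[R]_(d, k)) :
  (forall C, supp_sym H C -> X *m C *m Y^T = 0 -> C = 0) ->
  X *m P = 0 -> Y *m P = 0 -> L *m P = 1%:M -> supp_sym H (P *m W^T + W *m P^T) ->
  exists S : 'M[R]_d, S^T = - S /\ W = P *m S.
Proof.
move=> hXY XP YP LP hN.
have N0 : P *m W^T + W *m P^T = 0.
  apply: hXY => //; rewrite mulmxDr mulmxDl !mulmxA XP !mul0mx add0r.
  by rewrite -[_ *m P^T *m Y^T]mulmxA -trmx_mul YP trmx0 mulmx0.
have PW : P *m W^T = - (W *m P^T) by apply/eqP; rewrite -addr_eq0 N0.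
have PL : P^T *m L^T = 1%:M by rewrite -trmx_mul LP trmx1.
have sS : (L *m W)^T = - (L *m W).
  rewrite trmx_mul -[LHS]mul1mx -LP -mulmxA [P *m _]mulmxA PW mulNmx -mulmxA PL mulmx1.
  by rewrite mulmxN.
exists (L *m W); split=> //.
have := congr1 (mulmxr L^T) PW; rewrite /= -mulmxA -trmx_mul sS mulmxN mulNmx -mulmxA PL mulmx1.
by move/oppr_inj.
Qed.

(** The hub sits at the origin and velocities are taken relative to it. The edges at the hub make
    the diagonal of [N = P *m W^T + W *m P^T] vanish; given this, every other edge [u v] makes
    [N u v] vanish. *)
Lemma cone_inf_rigid (R : numFieldType) (b k d : nat) (H : rel 'I_k) (a : rel 'I_(1 + k)) :
  ssrbool.symmetric H -> irreflexive H ->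
  (forall u, a ord0 (rshift 1 u)) ->
  (forall u v, u != v -> ~~ H u v -> a (rshift 1 u) (rshift 1 v)) ->
  (d + 2 * b <= k)%N ->
  (exists X Y : 'M['F_2]_(b, k), forall C, supp_sym H C -> X *m C *m Y^T = 0 -> C = 0) ->
  exists q : 'M[R]_(1 + k, d), inf_rigid a q.
Proof.
move=> symH irrH a0 aH dbk [X2 [Y2 /(lift_nonisotropic R) [X [Y hXY]]]].
(* Each coordinate of the points must satisfy [2 * b] linear conditions, which leaves room for [d]
   independent coordinates. *)
have [|P' [P'free P'XY]] := @row_free_left_annihilator R k (b + b) d (row_mx X^T Y^T).
  by rewrite addnn -mul2n.
pose P := P'^T.
have XP : X *m P = 0.
  apply: trmx_inj; rewrite trmx_mul trmxK trmx0.
  by move/eqP: P'XY; rewrite mul_mx_row row_mx_eq0 => /andP[/eqP].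
have YP : Y *m P = 0.
  apply: trmx_inj; rewrite trmx_mul trmxK trmx0.
  by move/eqP: P'XY; rewrite mul_mx_row row_mx_eq0 => /andP[_ /eqP].
have [L LP] : exists L, L *m P = 1%:M.
  by apply/row_fullP; rewrite /row_full mxrank_tr.
exists (col_mx 0 P); apply: inf_rigidI.
  apply/row_fullP; exists (block_mx 1%:M 0 (- (L *m const_mx 1)) L).
  have -> : affmx (col_mx 0 P) = block_mx 1%:M 0 (const_mx 1) P.
    rewrite /affmx block_mxEh; congr row_mx; apply/matrixP => i j; rewrite !mxE.
    by case: splitP => l; rewrite !mxE // !ord1.
  rewrite mulmx_block !mul1mx !mul0mx !mulmx0 !addr0 !add0r mulmx1 addNr LP.
  by rewrite -scalar_mx_block.
move=> w mw.
have eqw u v : a u v -> \sum_c (col_mx 0 P u c - col_mx 0 P v c) * (w u c - w v c) = 0.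
  by move=> auv; move/matrixP: mw => /(_ u v); rewrite !mxE auv mul1r.
pose W : 'M[R]_(k, d) := \matrix_(u, c) (w (rshift 1 u) c - w ord0 c).
have P0 c : (col_mx (0 : 'M[R]_(1, d)) P) ord0 c = 0.
  by rewrite mxE; case: splitP => // j; rewrite mxE.
have diag u : \sum_c P u c * W u c = 0.
  rewrite -[RHS](eqw _ _ (a0 u)); apply: eq_bigr => c _.
  by rewrite P0 col_mxEd !mxE; ring.
have NE u v : (P *m W^T + W *m P^T) u v = \sum_c (P u c * W v c + W u c * P v c).
  by rewrite !mxE -big_split; apply: eq_bigr => c _; rewrite !mxE.
have hN : supp_sym H (P *m W^T + W *m P^T).
  apply/supp_symP; split; first by rewrite linearD /= !trmx_mul !trmxK addrC.
  move=> u v Huv; rewrite NE.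
  have [->|uv] := eqVneq u v.
    transitivity (\sum_c P v c * W v c + \sum_c P v c * W v c); last by rewrite diag addr0.
    rewrite -big_split; apply: eq_bigr => c _ /=.
    by rewrite [W v c * _]mulrC.
  have := eqw _ _ (aH u v uv Huv).
  rewrite (eq_bigr (fun c => P u c * W u c + P v c * W v c - (P u c * W v c + W u c * P v c))).
    by rewrite sumrB big_split /= !diag addr0 sub0r => /eqP; rewrite oppr_eq0 => /eqP.
  by move=> c _; rewrite !col_mxEd !mxE; ring.
have [S [sS WS]] := coned_motion_trivial hXY XP YP LP hN.
(* The translation is the velocity of the hub; the factor 1/2 undoes the doubling in [A - A^T]. *)
exists (col_mx (row ord0 w) (2%:R^-1 *: S)).
rewrite skewpart_of_skew // /affmx mul_row_col mul_col_mx mul0mx -WS.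
apply/matrixP => u c; rewrite !mxE big_ord1 !mxE mul1r.
case: splitP => j ej; rewrite !mxE.
  by rewrite addr0; congr (w _ _); apply: val_inj; rewrite /= ej ord1.
rewrite addrC subrK; congr (w _ _); apply: val_inj; exact: ej.
Qed.

(** * From infinitesimal rigidity to continuous rigidity *)

Section LocalRigidity.
Local Open Scope classical_set_scope.

Lemma cvg_det (R : realType) (T : Type) (F : set_system T) (n : nat)
    (A : T -> 'M[R]_n) (B : 'M[R]_n) :
  Filter F -> (forall i j, A t i j @[t --> F] --> B i j) ->
  \det (A t) @[t --> F] --> \det B.
Proof.
move=> FF AB; rewrite /determinant.
apply: cvg_big => [|s _]; first exact: add_continuous.
apply: cvgM; first exact: cvg_cst.
by apply: cvg_big => [|i _]; [exact: mul_continuous|exact: AB].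
Qed.

Lemma cvg_mulmx (R : realType) (T : Type) (F : set_system T) (m n p : nat)
    (A : T -> 'M[R]_(m, n)) (A' : 'M[R]_(m, n)) (B : T -> 'M[R]_(n, p)) (B' : 'M[R]_(n, p)) :
  Filter F -> (forall i j, A t i j @[t --> F] --> A' i j) ->
  (forall i j, B t i j @[t --> F] --> B' i j) ->
  forall i j, (A t *m B t) i j @[t --> F] --> (A' *m B') i j.
Proof.
move=> FF AA BB i j; rewrite mxE; under eq_fun do rewrite mxE.
by apply: cvg_big => [|k _]; [exact: add_continuous|apply: cvgM; [exact: AA|exact: BB]].
Qed.

(** Choose [L] and [C] with [L *m A' *m C] the identity of size [\rank A']. The determinant of
    [L *m A t *m C] tends to 1, so it is eventually nonzero. *)
Lemma rank_lower_semicontinuous (R : realType) (T : Type) (F : set_system T) (m n : nat)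
    (A : T -> 'M[R]_(m, n)) (A' : 'M[R]_(m, n)) :
  Filter F -> (forall i j, A t i j @[t --> F] --> A' i j) ->
  \forall t \near F, (\rank A' <= \rank (A t))%N.
Proof.
move=> FF AA.
have /row_fullP [L LC] : row_full (col_base A') := col_base_full A'.
have /row_freeP [C RC] : row_free (row_base A') := row_base_free A'.
have e1 : L *m A' *m C = 1%:M.
  transitivity ((L *m col_base A') *m (row_base A' *m C)); last by rewrite LC RC mulmx1.
  by rewrite -[RHS]mulmxA [col_base A' *m (_ *m _)]mulmxA mulmx_base mulmxA.
have : \det (L *m A t *m C) @[t --> F] --> \det (L *m A' *m C).
  apply: cvg_det => i j; apply: cvg_mulmx => [i' j'|i' j']; last exact: cvg_cst.
  by apply: cvg_mulmx => // i2 j2; exact: cvg_cst.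
rewrite e1 det1 => /cvgrPdist_lt /(_ 1 ltr01); apply: filterS => t ht.
have : \det (L *m A t *m C) != 0.
  by apply: contraTneq ht => ->; rewrite subr0 normr1 ltxx.
rewrite -unitfE -unitmxE => /mxrank_unit rk; rewrite -{1}rk.
by apply: leq_trans (mxrankM_maxl _ _) _; exact: mxrankM_maxr.
Qed.

(** In an ordered field [B *m B^T = 0] forces [B = 0], because the diagonal entries are sums of
    squares; so the two kernels agree. *)
Lemma mxrank_gram (R : realFieldType) (m n : nat) (A : 'M[R]_(m, n)) :
  \rank (A *m A^T) = \rank A.
Proof.
apply/eqP; rewrite eqn_leq mxrankM_maxl /=.
have : (kermx (A *m A^T) <= kermx A)%MS.
  apply/sub_kermxP; move: (mulmx_ker (A *m A^T)); set K := kermx _ => hK.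
  have : (K *m A) *m (K *m A)^T = 0 by rewrite trmx_mul mulmxA -[K *m A *m _]mulmxA hK mul0mx.
  move: (K *m A) => B h; apply/matrixP => i j; rewrite [RHS]mxE.
  move/matrixP: h => /(_ i i); rewrite !mxE => /eqP.
  rewrite psumr_eq0 => [/allP /(_ j)|k _]; last by rewrite mxE -expr2 sqr_ge0.
  by rewrite mem_index_enum => /(_ isT) /=; rewrite mxE mulf_eq0 orbb => /eqP.
move/mxrankS; rewrite !mxrank_ker; have := rank_leq_row A; have := rank_leq_row (A *m A^T); lia.
Qed.

Definition sqd (R : realFieldType) (n d : nat) (q : 'M[R]_(n, d)) (u v : 'I_n) : R :=
  \sum_c (q u c - q v c) ^+ 2.

Lemma mot_secant (R : realFieldType) (n d : nat) (a : rel 'I_n) (q q' : 'M[R]_(n, d)) u v :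
  mot a (q' + q) (q' - q) u v = (a u v)%:R * (sqd q' u v - sqd q u v).
Proof.
rewrite mxE; congr (_ * _); rewrite -sumrB; apply: eq_bigr => c _; rewrite !mxE; ring.
Qed.

Lemma polarization (R : realFieldType) (n d : nat) (q : 'M[R]_(n, d)) u v x y :
  \sum_c (q u c - q v c) * (q x c - q y c) =
  (sqd q u y + sqd q v x - sqd q u x - sqd q v y) / 2%:R.
Proof.
apply: (canRL (mulfK _)); first by rewrite pnatr_eq0.
rewrite mulr_suml -big_split -!sumrB; apply: eq_bigr => c _ /=; ring.
Qed.

Definition reldiff (R : realFieldType) (n d : nat) (o : 'I_n) (q : 'M[R]_(n, d)) : 'M[R]_(n, d) :=
  \matrix_(u, c) (q u c - q o c).

(** Measuring from a base vertex removes the column of ones. The Gram matrix of [reldiff] can then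
    be expressed through distances. *)
Lemma row_full_affmxE (R : realFieldType) (n d : nat) (o : 'I_n) (q : 'M[R]_(n, d)) :
  row_full (affmx q) = row_full (reldiff o q).
Proof.
have mulE (x : 'rV[R]_1) (y : 'rV[R]_d) (u : 'I_n) :
    (row_mx x y *m (affmx q)^T) 0 u = x 0 0 + \sum_c y 0 c * q u c.
  rewrite /affmx tr_row_mx mul_row_col !mxE big_ord1 !mxE mulr1; congr (_ + _).
  by apply: eq_bigr => c _; rewrite !mxE.
have relE (y : 'rV[R]_d) (u : 'I_n) :
    (y *m (reldiff o q)^T) 0 u = \sum_c y 0 c * q u c - \sum_c y 0 c * q o c.
  by rewrite mxE -sumrB; apply: eq_bigr => c _; rewrite !mxE mulrBr.
have frfull m' (A : 'M[R]_(n, m')) : row_full A = row_free A^T.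
  by rewrite /row_full /row_free mxrank_tr.
rewrite !frfull; apply/idP/idP => fr; apply: inj_row_free => y hy.
  pose x : 'rV[R]_1 := (- \sum_c y 0 c * q o c)%:M.
  have /(congr1 (mulmxr 1%:M)) : row_mx x y = 0.
    apply: (row_free_inj fr); rewrite mul0mx; apply/rowP => u.
    by rewrite mulE mxE eqxx mulr1n addrC -relE hy.
  by rewrite /= !mulmx1 => /eqP; rewrite row_mx_eq0 => /andP[_ /eqP].
rewrite -[y]hsubmxK in hy *; move: (lsubmx y) (rsubmx y) hy => {y} x y hy.
have hu u : x 0 0 + \sum_c y 0 c * q u c = 0 by rewrite -mulE hy mxE.
have y0 : y = 0.
  apply: (row_free_inj fr); rewrite mul0mx; apply/rowP => u.
  rewrite relE mxE; have := hu u; have := hu o; lra.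
have x0 : x = 0.
  apply/rowP => i; rewrite ord1 mxE -(hu o) y0 big1 ?addr0 // => c _.
  by rewrite mxE mul0r.
by rewrite x0 y0 row_mx0.
Qed.

Lemma rigmxE (S : comNzRingType) (n d : nat) (a : rel 'I_n) (q : 'M[S]_(n, d)) i c u v :
  rigmx a q (mxvec_index i c) (mxvec_index u v) =
  (a u v)%:R * ((q u c - q v c) * ((u == i)%:R - (v == i)%:R)).
Proof.
rewrite /rigmx /lin_mx !mxE /= vec_mx_delta mxvecE mxE; congr (_ * _).
rewrite (bigD1 c) //= big1 ?addr0 => [|c' /negbTE c'c]; rewrite !mxE ?eqxx ?andbT //.
by rewrite c'c !andbF subr0 mulr0.
Qed.

Lemma gram_rigmx (R : realFieldType) (n d : nat) (a : rel 'I_n) (q : 'M[R]_(n, d)) u v x y :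
  ((rigmx a q)^T *m rigmx a q) (mxvec_index u v) (mxvec_index x y) =
  (a u v)%:R * (a x y)%:R * (\sum_i ((u == i)%:R - (v == i)%:R) * ((x == i)%:R - (y == i)%:R))
   * ((sqd q u y + sqd q v x - sqd q u x - sqd q v y) / 2%:R).
Proof.
rewrite -polarization mxE.
rewrite (reindex _ (curry_mxvec_bij _ _)) /=.
transitivity (\sum_i \sum_c (rigmx a q)^T (mxvec_index u v) (mxvec_index i c) *
  rigmx a q (mxvec_index i c) (mxvec_index x y)).
  by rewrite pair_bigA; apply: eq_bigr => -[i c] _.
rewrite -mulrA mulr_suml mulr_sumr; apply: eq_bigr => i _.
rewrite mulr_sumr mulr_sumr; apply: eq_bigr => c _.
by rewrite mxE !rigmxE; ring.
Qed.

(* The Gram matrix of the rigidity matrix depends on the mutual distances only. *)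
Lemma inf_rigid_congruent (R : realFieldType) (n d : nat) (a : rel 'I_n) (q q' : 'M[R]_(n, d)) :
  (forall u v, sqd q u v = sqd q' u v) -> inf_rigid a q -> inf_rigid a q'.
Proof.
move=> e; rewrite /inf_rigid.
have -> : \rank (rigmx a q') = \rank (rigmx a q).
  rewrite -mxrank_tr -[RHS]mxrank_tr -(mxrank_gram (rigmx a q')^T) -(mxrank_gram (rigmx a q)^T).
  rewrite !trmxK; congr (\rank _).
  apply/matrixP => s t; case/mxvec_indexP: s => u v; case/mxvec_indexP: t => x y.
  by rewrite !gram_rigmx !e.
move=> /andP[fq ->]; rewrite andbT.
case: n a q q' e fq => [|n] a q q' e.
  by rewrite /row_full [affmx q]flatmx0 [affmx q']flatmx0.
rewrite !(row_full_affmxE ord0) /row_full.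
rewrite -(mxrank_gram (reldiff ord0 q)) -(mxrank_gram (reldiff ord0 q')).
suff -> : reldiff ord0 q *m (reldiff ord0 q)^T = reldiff ord0 q' *m (reldiff ord0 q')^T by [].
have g (p : 'M[R]_(n.+1, d)) u v : (reldiff ord0 p *m (reldiff ord0 p)^T) u v =
    \sum_c (p u c - p ord0 c) * (p v c - p ord0 c).
  by rewrite mxE; apply: eq_bigr => c _; rewrite !mxE.
by apply/matrixP => u v; rewrite !g !polarization !e.
Qed.

(** The secant argument works at [q' + q], twice the midpoint, which tends to [q + q] as [q'] tends
    to [q]. *)
Lemma inf_rigid_scale (R : realFieldType) (n d : nat) (a : rel 'I_n) (q : 'M[R]_(n, d)) :
  inf_rigid a q -> inf_rigid a (q + q).
Proof.
move=> rq; have /andP[fq _] := rq; apply: inf_rigidI.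
  have /row_fullP [L LH] := fq.
  have e : affmx (q + q) = affmx q *m block_mx 1%:M 0 0 2%:R%:M.
    rewrite /affmx mul_row_block !mulmx0 addr0 add0r mulmx1; congr row_mx.
    by rewrite mul_mx_scalar scaler_nat mulr2n.
  apply/row_fullP; exists (block_mx 1%:M 0 0 2%:R^-1%:M *m L).
  rewrite e mulmxA -[_ *m L *m _]mulmxA LH mulmx1 mulmx_block !mulmx0 !mul0mx !addr0 !add0r mulmx1.
  by rewrite -scalar_mxM mulVf ?pnatr_eq0 // -scalar_mx_block.
move=> w mw.
have m2 : mot a (q + q) w = 2%:R *: mot a q w.
  apply/matrixP => u v; rewrite [RHS]mxE [in LHS]mxE [in RHS]mxE [RHS]mulrCA [2%:R * _]mulr_sumr; congr (_ * _).
  by apply: eq_bigr => c _; rewrite !mxE; ring.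
have mw' : mot a q w = 0.
  by apply/eqP; move/eqP: mw; rewrite m2 scaler_eq0 pnatr_eq0.
have [B ->] := inf_rigid_motion rq mw'.
(* Doubled points need half the rotation part for the same velocities. *)
exists (col_mx (usubmx B) (2%:R^-1 *: dsubmx B)).
have -> : skewpart (col_mx (usubmx B) (2%:R^-1 *: dsubmx B)) =
    col_mx (usubmx B) (2%:R^-1 *: (dsubmx B - (dsubmx B)^T)).
  by rewrite /skewpart col_mxKu col_mxKd linearZ /= -scalerBr.
rewrite /affmx /skewpart !mul_row_col; congr (_ + _).
by rewrite -scalemxAr mulmxDl scalerDr -scalerDl -[LHS]scale1r; congr (_ *: _); field.
Qed.

Lemma inf_rigid_near (R : realType) (T : Type) (F : set_system T) (n d : nat) (a : rel 'I_n)
    (q : T -> 'M[R]_(n, d)) (q' : 'M[R]_(n, d)) :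
  Filter F -> (forall i j, q t i j @[t --> F] --> q' i j) -> inf_rigid a q' ->
  \forall t \near F, inf_rigid a (q t).
Proof.
move=> FF qq /andP[f1 f2].
have h1 : \forall t \near F, (\rank (affmx q') <= \rank (affmx (q t)))%N.
  apply: rank_lower_semicontinuous => i j; rewrite mxE; under eq_fun do rewrite mxE.
  by case: (fintype.split j) => k; [under eq_fun do rewrite mxE; rewrite ?mxE; exact: cvg_cst | exact: qq].
have h2 : \forall t \near F, (\rank (rigmx a q') <= \rank (rigmx a (q t)))%N.
  apply: rank_lower_semicontinuous => i j.
  case/mxvec_indexP: i => i c; case/mxvec_indexP: j => u v; rewrite rigmxE.
  under eq_fun do rewrite rigmxE.
  apply: cvgM; first exact: cvg_cst.
  by apply: cvgM; [apply: cvgB; exact: qq|exact: cvg_cst].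
near=> t; apply/andP; split.
  rewrite /row_full eqn_leq rank_leq_col /= -{1}(eqP f1); near: t; exact: h1.
apply: leq_trans f2 _; rewrite leq_add2r; near: t; exact: h2.
Unshelve. all: by end_near.
Qed.

Definition config (R : realFieldType) (n d : nat) (p : 'I_n -> 'I_d -> R) : 'M[R]_(n, d) :=
  \matrix_(u, c) p u c.

Lemma sqd_config (R : realType) (n d : nat) (p : 'I_n -> 'I_d -> R) u v :
  sqd (config p) u v = sqdist p u v.
Proof. by apply: eq_bigr => c _; rewrite !mxE. Qed.

(* The secant vector [q' - q] of two frameworks with the same edge lengths is an infinitesimal
   motion of their midpoint, so it is trivial there. *)
Lemma inf_rigid_secant (R : realType) (n d : nat) (a : rel 'I_n) (q q' : 'M[R]_(n, d)) :
  inf_rigid a (q' + q) -> (forall u v, a u v -> sqd q' u v = sqd q u v) ->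
  forall u v, sqd q' u v = sqd q u v.
Proof.
move=> rq e u v.
have [|B eB] := inf_rigid_motion (w := q' - q) rq.
  apply/matrixP => x y; rewrite mot_secant mxE.
  by case: (boolP (a x y)) => [/e ->|_]; rewrite ?subrr ?mulr0 ?mul0r.
have := mot_secant (fun _ _ => true) q q' u v.
rewrite eB mot_skewpart mxE mul1r => h.
by apply/eqP; rewrite -subr_eq0 -h.
Qed.

(** The times in the unit interval at which all distances are the initial ones form a nonempty, open
    and closed set. For openness, the framework at such a time is congruent to [p], hence
    infinitesimally rigid, and [inf_rigid_secant] applies at nearby times; closedness is continuity
    of the distances. *)
Lemma inf_rigid_framework_rigid (R : realType) (n d : nat) (E : {set {set 'I_n}})
    (p : 'I_n -> 'I_d -> R) :
  inf_rigid (adj E) (config p) -> framework_rigid E p.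
Proof.
move=> rp [P [cP P0 PE [t [u [v [t01]]]]]]; apply/negP; rewrite negbK; apply/eqP.
pose I01 : set R := `[0, 1]%classic; pose F (s : R) := within I01 (nbhs s).
pose B := [set s : R | I01 s /\ forall x y, sqdist (P s) x y = sqdist p x y].
have cvP s x c : I01 s -> P r x c @[r --> F s] --> P s x c.
  by move=> s01; have /subspace_continuousP := cP x c; apply.
have cvD s x y : I01 s -> sqdist (P r) x y @[r --> F s] --> sqdist (P s) x y.
  move=> s01; apply: cvg_big => [|c _]; first exact: add_continuous.
  by under eq_fun do rewrite expr2; rewrite expr2; apply: cvgM; apply: cvgB; exact: cvP.
have nearB s : B s -> \forall r \near F s, forall x y, sqdist (P r) x y = sqdist p x y.
  move=> [s01 Bs].
  have rs : inf_rigid (adj E) (config (P s) + config (P s)).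
    apply: inf_rigid_scale; apply: inf_rigid_congruent rp => x y.
    by rewrite !sqd_config Bs.
  have h : \forall r \near F s, inf_rigid (adj E) (config (P r) + config (P s)).
    apply: inf_rigid_near rs => i j; rewrite !mxE; under eq_fun do rewrite !mxE.
    by apply: cvgD; [exact: cvP|exact: cvg_cst].
  have h01 : \forall r \near F s, I01 r by apply: withinT; exact: nbhs_filter.
  near=> r => x y; rewrite -Bs -!sqd_config.
  apply: (@inf_rigid_secant _ _ _ (adj E)); first by near: r.
  move=> x' y' axy; rewrite !sqd_config Bs PE //.
  by near: r.
suff BI : B = I01.
  by have : I01 t by []; rewrite -BI => -[_]; apply.
apply: (@segment_connected R 0 1).
- exists 0; split; first by rewrite /I01 /= in_itv /= lexx ler01.
  by move=> x y; rewrite P0.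
- exists (interior [set s | I01 s -> B s]); first exact: open_interior.
  apply/seteqP; split=> [s Bs|s [s01 /interior_subset]]; last by apply.
  split; first by case: Bs.
  rewrite /interior /=; have := nearB s Bs; rewrite /F near_withinE => h.
  by apply: filterS h => r hr r01; split=> //; exact: hr.
- exists (closure B); first exact: closed_closure.
  apply/seteqP; split=> [s Bs|s [s01 cs]].
    by split; [case: Bs|exact: subset_closure].
  split=> // x y; apply/eqP; apply: contraT => ne.
  have := cvD s x y s01 => /cvgrPdist_lt /(_ `|sqdist (P s) x y - sqdist p x y|).
  rewrite normr_gt0 subr_eq0 => /(_ ne); rewrite /F near_withinE => h.
  by have [r [[r01 Br] /(_ r01)]] := cs _ h; rewrite Br ltxx.
Unshelve. all: by end_near.
Qed.

End LocalRigidity.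

(** * Generic points *)

Section GenericPoints.
Local Open Scope classical_set_scope.

Lemma countable_proper (R : realType) (A : set R) : countable A -> exists x, ~ A x.
Proof.
move=> cA; apply/existsNP => hA.
have := countable_lebesgue_measure0 cA; have -> : A = setT by apply/seteqP; split.
by rewrite -set_itvNyy lebesgue_measure_itv.
Qed.

(** [insub] fails exactly at the last index, where the default [t] becomes the value of the variable
    singled out by [muni]. *)
Lemma horner_muni (R : comNzRingType) (n : nat) (p : {mpoly R[n.+1]}) (x : 'I_n -> R) (t : R) :
  p.@[fun i => oapp x t (insub (i : nat))] = (map_poly (meval x) (muni p)).[t].
Proof.
rewrite mevalE muniE.
rewrite raddf_sum horner_sum; apply: eq_bigr => m _.
rewrite /= map_polyZ /= map_polyXn hornerZ hornerXn mevalZ mevalX -mulrA; congr (_ * _).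
rewrite big_ord_recr /=; congr (_ * _ ^+ _); last by rewrite insubF //= ltnn.
apply: eq_bigr => i _; rewrite mnmE; congr (_ ^+ _).
by rewrite (insubT (fun j => (j < n)%N) (ltn_ord i)) /=; congr x; apply: val_inj.
Qed.

Lemma muni_eq0 (R : comNzRingType) (n : nat) (p : {mpoly R[n.+1]}) : muni p = 0 -> p = 0.
Proof.
move=> p0; apply/mpolyP => m; rewrite mcoeff0.
pose low (m : 'X_{1..n.+1}) := [multinom m (widen_ord (leqnSn n) i) | i < n].
have inj m' : low m' = low m -> m' ord_max = m ord_max -> m' = m.
  move=> /mnmP e e'; apply/mnmP => i; case: (unliftP ord_max i) => [j|] ->; last exact: e'.
  have wl : widen_ord (leqnSn n) j = lift ord_max j.
    by apply: val_inj; rewrite /= /bump leqNgt ltn_ord.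
  by have := e j; rewrite !mnmE wl.
have := congr1 (fun q : {poly {mpoly R[n]}} => q`_(m ord_max)) p0.
rewrite muniE coef0 coef_sum => /(congr1 (mcoeff (low m))); rewrite mcoeff0 raddf_sum /=.
rewrite (eq_bigr (fun m2 => p@_m2 * (m2 == m)%:R)) => [h|m2 _]; last first.
  rewrite coefZ coefXn; have [->|ne] := eqVneq m2 m.
    by rewrite eqxx mulr1 mcoeffZ mcoeffX eqxx.
  have [e'|_] := eqVneq (m ord_max) (m2 ord_max); last by rewrite mulr0 mcoeff0 mulr0.
  rewrite mulr1 mcoeffZ mcoeffX; case: eqP => // e.
  by case/eqP: ne; apply: inj.
have [ms|/memN_msupp_eq0 //] := boolP (m \in msupp p).
move: h; rewrite (bigD1_seq m) ?msupp_uniq //= eqxx mulr1 big1 ?addr0 // => m2 /negbTE ->.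
by rewrite mulr0.
Qed.

Lemma finite_roots (R : idomainType) (p : {poly R}) :
  p != 0 -> exists s : seq R, forall t, root p t -> t \in s.
Proof.
move: {2}(size p) (leqnn (size p)) => n; elim: n p => [|n IH] p.
  by rewrite leqn0 size_poly_eq0 => ->.
move=> sp p0; have [[t rt]|nr] := pselect (exists t, root p t); last first.
  by exists [::] => t rt; case: nr; exists t.
have /factor_theorem [q eq] := rt.
have q0 : q != 0 by apply: contraNneq p0 => q0; rewrite eq q0 mul0r.
have [|s hs] := IH q _ q0.
  by move: sp; rewrite eq size_Mmonic ?monicXsubC // size_XsubC addn2.
exists (t :: s) => u; rewrite eq rootM root_XsubC inE orbC.
by case/orP => [->//|/hs ->]; rewrite orbT.
Qed.

(** Induction on the number of variables. First avoid the zeros of the leading coefficients in the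
    last variable; then each nonzero polynomial forbids finitely many values of that variable, so
    countably many in total. *)
Lemma exists_common_nonroot (R : realType) (D : countType) (n : nat) (f : D -> {mpoly R[n]}) :
  exists x : 'I_n -> R, forall k, f k != 0 -> (f k).@[x] != 0.
Proof.
elim: n f => [|n IH] f.
  by exists (fun=> 0) => k; rewrite [f k]nvar0_mpolyC mevalC mpolyC_eq0.
have [x hx] := IH (fun k => lead_coef (muni (f k))).
pose P k : {poly R} := map_poly (meval x) (muni (f k)).
have P0 k : f k != 0 -> P k != 0.
  move=> fk; have mk : muni (f k) != 0 by apply: contraNneq fk => /muni_eq0 ->.
  apply/eqP => /(congr1 (fun q : {poly R} => q`_(size (muni (f k))).-1)).
  rewrite coef_map coef0 /=; apply/eqP; apply: hx; by rewrite lead_coef_eq0.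
have cb : countable (\bigcup_(k in setT) [set t : R | P k != 0 /\ root (P k) t]).
  apply: bigcup_countable => [|k _]; first exact: countableP.
  have [Pk|Pk] := eqVneq (P k) 0; first by apply: sub_countable (countable0 R); apply: subset_card_le => t [].
  have [s Ps] := finite_roots Pk.
  apply: finite_set_countable; apply: (@sub_finite_set _ _ [set` s]); last exact: finite_seq.
  by move=> t [_ /Ps].
have [t ht] := countable_proper cb.
exists (fun i => oapp x t (insub (i : nat))) => k fk; rewrite horner_muni.
by apply/negP => Pt; apply: ht; exists k => //; split; first exact: P0.
Qed.

Definition evalm (R : realType) (I : finType) (x : I -> R) : {mpoly rat[#|I|]} -> R :=
  mmap (ratr : rat -> R) (fun j => x (enum_val j)).

HB.instance Definition _ (R : realType) (I : finType) (x : I -> R) :=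
  GRing.RMorphism.copy (@evalm R I x) (mmap (ratr : rat -> R) (fun j => x (enum_val j))).

(** Indexing the rational polynomials by finite lists of terms makes the family countable. *)
Lemma exists_alg_indep (R : realType) (I : finType) : exists x : I -> R, alg_indep x.
Proof.
pose N := #|I|.
pose f (s : seq ('X_{1..N} * rat)) : {mpoly R[N]} := \sum_(t <- s) ratr t.2 *: 'X_[t.1].
have [x hx] := exists_common_nonroot f.
exists (fun i => x (enum_rank i)) => q q0.
have -> : (fun j => x (enum_rank (enum_val j))) = x by apply/funext => j; rewrite enum_valK.
pose s := [seq (m, q@_m) | m <- msupp q].
have fs0 : f s != 0.
  have [m ms] : exists m, m \in msupp q.
    case E : (msupp q) => [|m s']; last by exists m; rewrite inE eqxx.
    by move/eqP: E; rewrite msupp_eq0 (negbTE q0).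
  apply/eqP => /(congr1 (mcoeff m)); rewrite mcoeff0 /f big_map raddf_sum /=.
  rewrite (bigD1_seq m) ?msupp_uniq //= mcoeffZ mcoeffX eqxx mulr1 big1 ?addr0.
    by move/eqP; rewrite fmorph_eq0 mcoeff_eq0 ms.
  by move=> m2 /negbTE ne; rewrite mcoeffZ mcoeffX ne mulr0.
have := hx s fs0; suff -> : (f s).@[x] = mmap (ratr : rat -> R) x q by [].
rewrite /f big_map raddf_sum /mmap; apply: eq_bigr => m _ /=.
by rewrite mevalZ mevalX.
Qed.

(** A minor that is nonzero at [y] is a nonzero rational polynomial, hence nonzero at [x]. *)
Lemma alg_indep_rank (R : realType) (I : finType) (x y : I -> R) (m n : nat)
    (M : 'M[{mpoly rat[#|I|]}]_(m, n)) :
  alg_indep x -> (\rank (map_mx (evalm y) M) <= \rank (map_mx (evalm x) M))%N.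
Proof.
move=> ax; set A := map_mx (evalm y) M.
pose f := maxrankfun A; have frA : row_free (rowsub f A) := maxrowsub_free A.
have fullA : row_full (rowsub f A)^T by rewrite /row_full mxrank_tr.
pose g := fullrankfun fullA.
have eqsub (B : 'M[R]_(m, n)) : rowsub g (rowsub f B)^T = (mxsub f g B)^T.
  by apply/matrixP => i j; rewrite !mxE.
have : \det (mxsub f g A) != 0.
  by rewrite -unitfE -unitmxE -unitmx_tr -eqsub fullrowsub_unit.
have evdet (z : I -> R) : \det (mxsub f g (map_mx (evalm z) M)) = evalm z (\det (mxsub f g M)).
  by rewrite -det_map_mx map_mxsub.
rewrite evdet => dy.
have q0 : \det (mxsub f g M) != 0 by apply: contraNneq dy => ->; rewrite rmorph0.
have := ax _ q0; rewrite -/(evalm x (\det (mxsub f g M))) -evdet -unitfE -unitmxE => /mxrank_unit rk.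
rewrite -{1}rk -mxrank_tr -eqsub rowsubE.
apply: leq_trans (mxrankM_maxr _ _) _; rewrite mxrank_tr rowsubE; exact: mxrankM_maxr.
Qed.

Definition family_mx (T : Type) (n d : nat) (x : 'I_n * 'I_d -> T) : 'M[T]_(n, d) :=
  \matrix_(i, c) x (i, c).

Definition coord_mx (n d : nat) : 'M[{mpoly rat[#|{: 'I_n * 'I_d}|]}]_(n, d) :=
  family_mx (fun ic => 'X_(enum_rank ic)).

Lemma evalm_coord_mx (R : realType) (n d : nat) (x : 'I_n * 'I_d -> R) :
  map_mx (evalm x) (coord_mx n d) = family_mx x.
Proof. by apply/matrixP => i c; rewrite !mxE /evalm mmapX mmap1U enum_rankK. Qed.

Lemma rowsub_affmx (S : comNzRingType) (n m d : nat) (h : 'I_m -> 'I_n) (q : 'M[S]_(n, d)) :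
  affmx (rowsub h q) = rowsub h (affmx q).
Proof.
by apply/matrixP => i j; rewrite !mxE; case: (fintype.split j) => *; rewrite !mxE.
Qed.

Lemma row_full_affmx_rowsub (F : fieldType) (n m d : nat) (h : 'I_m -> 'I_n) (q : 'M[F]_(n, d)) :
  row_full (affmx (rowsub h q)) -> row_full (affmx q).
Proof.
rewrite rowsub_affmx rowsubE /row_full => /eqP r.
by rewrite eqn_leq rank_leq_col -{1}r mxrankM_maxr.
Qed.

Lemma alg_indep_inf_rigid (R : realType) (N n d : nat) (a : rel 'I_n) (h : 'I_n -> 'I_N)
    (x : 'I_N * 'I_d -> R) (q : 'M[R]_(n, d)) :
  alg_indep x -> injective h -> inf_rigid a q -> inf_rigid a (rowsub h (family_mx x)).
Proof.
move=> ax hinj.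
(* The special placement extends [q] along [h], with 0 at the points outside the image. *)
pose y (ic : 'I_N * 'I_d) : R := oapp (fun j => q j ic.2) 0 [pick j | h j == ic.1].
have <- : rowsub h (family_mx y) = q.
  apply/matrixP => i c; rewrite !mxE /y /=; case: pickP => [j /eqP/hinj -> //|/(_ i)].
  by rewrite eqxx.
move=> /andP[f1 f2]; apply/andP; split.
  have := @alg_indep_rank R _ x y _ _ (affmx (rowsub h (coord_mx N d))) ax.
  have ev z : map_mx (evalm z) (affmx (rowsub h (coord_mx N d))) = affmx (rowsub h (family_mx z)).
    rewrite /affmx map_row_mx map_mxsub evalm_coord_mx; congr row_mx.
    by apply/matrixP => i j; rewrite !mxE rmorph1.
  by rewrite !ev /row_full (eqP f1) eqn_leq rank_leq_col.
apply: leq_trans f2 _; rewrite leq_add2r.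
have := @alg_indep_rank R _ x y _ _ (rigmx a (rowsub h (coord_mx N d))) ax.
by rewrite !map_rigmx !map_mxsub !evalm_coord_mx.
Qed.

Lemma inf_rigid_d_rigid (R : realType) (n d : nat) (E : {set {set 'I_n}}) (q : 'M[R]_(n, d)) :
  inf_rigid (adj E) q -> d_rigid R d E.
Proof.
move=> rq; have [x ax] := @exists_alg_indep R ('I_n * 'I_d)%type.
exists (fun i c => x (i, c)); split.
  by rewrite /generic (_ : (fun ik => _) = x) //; apply/funext => -[].
apply: inf_rigid_framework_rigid.
have := alg_indep_inf_rigid (h := id) ax (@inj_id _) rq.
by congr (inf_rigid _ _); apply/matrixP => i j; rewrite !mxE.
Qed.

(** The differences to the point [i] are linearly independent, since they already are when [f j]
    sits at the [j]-th unit vector and all other points at the origin. *)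
Lemma alg_indep_general_position (R : realType) (n d : nat) (x : 'I_n * 'I_d -> R)
    (i : 'I_n) (f : 'I_d -> 'I_n) (v : 'I_d -> R) :
  alg_indep x -> injective f -> (forall j, f j != i) ->
  (forall j, \sum_c (x (f j, c) - x (i, c)) * v c = 0) -> forall c, v c = 0.
Proof.
move=> ax finj fi hv.
pose M (S : comNzRingType) (z : 'M[S]_(n, d)) : 'M[S]_d := \matrix_(j, c) (z (f j) c - z i c).
pose y (ic : 'I_n * 'I_d) : R := (f ic.2 == ic.1)%:R.
have My : M R (family_mx y) = 1%:M.
  apply/matrixP => j c; rewrite !mxE /y /= (inj_eq finj) [f c == i](negbTE (fi c)) subr0.
  by rewrite eq_sym.
have := @alg_indep_rank R _ x y _ _ (M _ (coord_mx n d)) ax.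
have ev z : map_mx (evalm z) (M _ (coord_mx n d)) = M R (family_mx z).
  by rewrite -evalm_coord_mx; apply/matrixP => j c; rewrite !mxE rmorphB.
rewrite !ev My mxrank1 => rM.
have fM : row_free (M R (family_mx x))^T by rewrite /row_free mxrank_tr eqn_leq rank_leq_row.
have v0 : (\row_c v c) = 0.
  apply: (row_free_inj fM); rewrite mul0mx; apply/rowP => j; rewrite !mxE -[RHS](hv j).
  by apply: eq_bigr => c _; rewrite !mxE mulrC.
by move=> c; move/rowP: v0 => /(_ c); rewrite !mxE.
Qed.

Lemma mot_eq0P (S : comNzRingType) (n d : nat) (a : rel 'I_n) (q w : 'M[S]_(n, d)) :
  mot a q w = 0 <-> (forall u v, a u v -> \sum_c (q u c - q v c) * (w u c - w v c) = 0).
Proof.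
split=> [h u v auv|h]; first by move/matrixP: h => /(_ u v); rewrite !mxE auv mul1r.
apply/matrixP => u v; rewrite !mxE; case: (boolP (a u v)) => [/h ->|_]; first by rewrite mulr0.
by rewrite mul0r.
Qed.

Definition classadj (n N : nat) (E : {set {set 'I_n}}) (phi : 'I_n -> 'I_N) : rel 'I_N :=
  fun i j => [exists u, exists v, [&& phi u == i, phi v == j & adj E u v]].

(* Placing each class at a single generic point, [d] common neighbours in distinct classes
   force two vertices of the same class to move in the same way. *)
Lemma inf_rigid_classes (R : realType) (n N K d : nat) (E : {set {set 'I_n}})
    (phi : 'I_n -> 'I_N) (psi : 'I_N -> 'I_n) (h : 'I_(1 + K) -> 'I_N) (q : 'M[R]_(1 + K, d)) :
  cancel psi phi ->
  (forall u, exists2 f : 'I_d -> 'I_N, injective f &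
     forall j, f j != phi u /\
       (u = psi (phi u) \/ exists c, [/\ phi c = f j, adj E c u & adj E c (psi (phi u))])) ->
  injective h -> inf_rigid (fun i j => classadj E phi (h i) (h j)) q ->
  (forall i, (forall j, h j != i) ->
     exists2 f : 'I_d -> 'I_(1 + K), injective f & forall j, classadj E phi i (h (f j))) ->
  exists q' : 'M[R]_(n, d), inf_rigid (adj E) q'.
Proof.
move=> psiK merge hinj rq attach.
have [x ax] := @exists_alg_indep R ('I_N * 'I_d)%type.
pose z := family_mx x.
have rcore : inf_rigid (fun i j => classadj E phi (h i) (h j)) (rowsub h z).
  exact: alg_indep_inf_rigid ax hinj rq.
exists (rowsub phi z); apply: inf_rigidI.
  apply: (@row_full_affmx_rowsub _ _ _ _ (fun i => psi (h i))).
  have /andP[fh _] := rcore; congr (is_true (row_full (affmx _))): fh.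
  by apply/matrixP => i c; rewrite !mxE psiK.
move=> w /mot_eq0P mw.
have wpsi u c : w u c = w (psi (phi u)) c.
  have [f finj hf] := merge u.
  have [{1}->//|neq] := eqVneq u (psi (phi u)).
  apply/eqP; rewrite -subr_eq0; apply/eqP; move: c.
  apply: (alg_indep_general_position ax finj (fun j => (hf j).1)) => j.
  have [_ [e|[c [ec a1 a2]]]] := hf j; first by case/eqP: neq.
  (* The edges from [c] to [u] and to [psi (phi u)] have the same direction, since both far ends
     occupy one point. Subtracting their equations eliminates the velocity of [c]. *)
  rewrite -[RHS](subrr 0) -[X in _ = X - _](mw _ _ a2) -[X in _ = _ - X](mw _ _ a1).
  by rewrite -sumrB; apply: eq_bigr => c' _; rewrite !mxE psiK ec; ring.
pose W := rowsub psi w.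
have wW : w = rowsub phi W by apply/matrixP => u c; rewrite !mxE -wpsi.
have mW : mot (classadj E phi) z W = 0.
  apply/mot_eq0P => i j /existsP [u /existsP [v /and3P[/eqP <- /eqP <- auv]]].
  by rewrite -[RHS](mw _ _ auv); apply: eq_bigr => c _; rewrite !mxE -!wpsi.
have [|B eB] := inf_rigid_motion (w := rowsub h W) rcore.
  apply/mot_eq0P => i j aij; move/mot_eq0P: mW => /(_ _ _ aij) e; rewrite -[RHS]e.
  by apply: eq_bigr => c _; rewrite !mxE.
suff WB : W = affmx z *m skewpart B.
  exists B; rewrite wW WB rowsub_affmx; apply/matrixP => u c; rewrite !mxE.
  by apply: eq_bigr => e _; rewrite !mxE.
(* After removal of the trivial motion found on the core, [D] vanishes there. At any other point it
   is orthogonal to [d] independent directions, so it vanishes as well. *)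
have mD : mot (classadj E phi) z (W - affmx z *m skewpart B) = 0.
  by rewrite linearB /= mW mot_skewpart subrr.
set D := W - _ in mD; apply/eqP; rewrite -subr_eq0 -/D; apply/eqP/matrixP => i c.
have Dh j c' : D (h j) c' = 0.
  move/matrixP: eB => /(_ j c'); rewrite rowsub_affmx !mxE => ->.
  by apply/eqP; rewrite subr_eq0; apply/eqP; apply: eq_bigr => e _; rewrite !mxE.
rewrite [RHS]mxE; have [/existsP [j /eqP <-]|] := boolP [exists j, h j == i]; first exact: Dh.
rewrite negb_exists => /forallP hi; have [f finj hf] := attach i hi.
apply: (alg_indep_general_position ax (inj_comp hinj finj)) c => [j|j]; first exact: hi.
move/mot_eq0P: mD => /(_ _ _ (hf j)) e.
apply/eqP; rewrite -oppr_eq0 -sumrN -[X in _ == X]e; apply/eqP; apply: eq_bigr => c' _.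
by rewrite Dh subr0 !mxE /=; ring.
Qed.

End GenericPoints.

(** * A deterministic criterion *)

Lemma exists_injection_in (T : finType) (S : {set T}) (d : nat) :
  (d <= #|S|)%N -> exists2 f : 'I_d -> T, injective f & forall j, f j \in S.
Proof.
move=> dS; exists (fun j => enum_val (widen_ord dS j)); last by move=> j; exact: enum_valP.
by move=> i j /enum_val_inj /(congr1 val) /= /val_inj.
Qed.

Lemma pairL_subproof (n k : nat) (hk : (2 * k <= n)%N) (j : 'I_k) : (j < n)%N.
Proof. by have := ltn_ord j; lia. Qed.

Lemma pairR_subproof (n k : nat) (hk : (2 * k <= n)%N) (j : 'I_k) : (j + k < n)%N.
Proof. by have := ltn_ord j; lia. Qed.

(** Vertices below [2 * k] form the pairs [j], [j + k]; the vertices from [2 * k] on stay single. *)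
Definition pairL (n k : nat) (hk : (2 * k <= n)%N) (j : 'I_k) : 'I_n :=
  Ordinal (pairL_subproof hk j).
Definition pairR (n k : nat) (hk : (2 * k <= n)%N) (j : 'I_k) : 'I_n :=
  Ordinal (pairR_subproof hk j).

Definition common (n k : nat) (hk : (2 * k <= n)%N) (E : {set {set 'I_n}}) (i : 'I_k) (a : 'I_n) :=
  adj E a (pairL hk i) && adj E a (pairR hk i).

(** Points are counted rather than vertices: another pair counts once even if both its vertices are
    common neighbours, since both lie at the same point. *)
Definition pairs_merge (n k d : nat) (hk : (2 * k <= n)%N) (E : {set {set 'I_n}}) : bool :=
  [forall i : 'I_k, d <= #|[set j : 'I_k | (j != i) &&
       (common hk E i (pairL hk j) || common hk E i (pairR hk j))]| +
     #|[set s : 'I_n | (2 * k <= s) && common hk E i s]|]%N.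

Definition singles_attach (n k t : nat) (hk : (2 * k <= n)%N) (E : {set {set 'I_n}}) : bool :=
  [forall s : 'I_n, (2 * k <= s) ==>
    (#|[set j : 'I_k | ~~ adj E s (pairL hk j) && ~~ adj E s (pairR hk j)]| <= t)]%N.

Definition pairs_dense (n k t : nat) (hk : (2 * k <= n)%N) (E : {set {set 'I_n}}) : bool :=
  [forall i : 'I_k, #|[set j : 'I_k | (j != i) &&
     [&& ~~ adj E (pairL hk i) (pairL hk j), ~~ adj E (pairL hk i) (pairR hk j),
         ~~ adj E (pairR hk i) (pairL hk j) & ~~ adj E (pairR hk i) (pairR hk j)]]| <= t]%N.

(* [t] is a bound for the logarithm of [3 m]. *)
Lemma core_exponents (m t : nat) :
  (64 * t <= m)%N -> (64 <= m)%N -> (3 * m <= 2 ^ t)%N ->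
  let K := (13 * m).-1 in let b := (3 * m).-1 in let e := ((9 * m - 3) %/ 4)%N in
  let M := (K * m)./2 in
  [/\ (4 * e <= 3 * b)%N,
      (b.+1 * (K * 2 ^ m * b.+1 ^ 2) <= 2 ^ e)%N &
      (b.+1 * (2 ^ M * b.+1 ^ b.+1) <= 2 ^ (e * b))%N].
Proof.
move=> tm m64 m3 K b e M.
have eb : b.+1 = (3 * m)%N by rewrite /b prednK //; lia.
have he : (9 * m <= 4 * e + 6)%N by rewrite /e; lia.
split; first by rewrite /e /b; lia.
  (* Here [K <= 13 * m <= 8 * (3 * m) <= 2 ^ (t + 3)]. *)
  rewrite eb; apply: leq_trans (_ : 2 ^ t * (2 ^ (t + 3) * 2 ^ m * (2 ^ t) ^ 2) <= _)%N.
    apply: leq_mul => //; apply: leq_mul; last by rewrite leq_exp2r.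
    rewrite leq_mul2r; apply/orP; right; rewrite expnD /K; lia.
  by rewrite -expnM -!expnD leq_pexp2l //; lia.
rewrite eb; apply: leq_trans (_ : 2 ^ t * (2 ^ M * (2 ^ t) ^ (3 * m)) <= _)%N.
  apply: leq_mul => //; rewrite leq_mul2l; apply/orP; right.
  by rewrite leq_exp2r //; lia.
rewrite -expnM -!expnD leq_pexp2l //.
(* To leading order [4 * M] is at most [26 * m ^ 2] while [4 * (e * b)] is about [27 * m ^ 2]; the
   difference absorbs the terms in [t] and the linear terms. *)
have hM : (2 * M <= (13 * m) * m)%N.
  have : (2 * M <= K * m)%N by rewrite /M; lia.
  by move=> h; apply: leq_trans h _; rewrite leq_mul2r /K; lia.
have hb : (b = 3 * m - 1)%N by rewrite /b; lia.
have h1 : (64 * (t * (3 * m)) <= m * (3 * m))%N by rewrite mulnA leq_mul2r tm orbT.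
have h2 : ((9 * m - 6) * b <= 4 * (e * b))%N by rewrite mulnA leq_mul2r; apply/orP; right; lia.
have h3 : (64 * m <= m * m)%N by rewrite leq_mul2r m64 orbT.
rewrite hb in h2 *; rewrite mulnBr mulnBl in h2.
nia.
Qed.

Lemma adjC (n : nat) (E : {set {set 'I_n}}) : ssrbool.symmetric (adj E).
Proof. by move=> u v; rewrite /adj finset.setUC. Qed.

Lemma classadjC (n N : nat) (E : {set {set 'I_n}}) (phi : 'I_n -> 'I_N) :
  ssrbool.symmetric (classadj E phi).
Proof.
move=> i j; apply/existsP/existsP => -[u /existsP [v /and3P[h1 h2 h3]]];
  by exists v; apply/existsP; exists u; rewrite h1 h2 adjC h3.
Qed.

Lemma classadjI (n N : nat) (E : {set {set 'I_n}}) (phi : 'I_n -> 'I_N) u v :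
  adj E u v -> classadj E phi (phi u) (phi v).
Proof. by move=> uv; apply/existsP; exists u; apply/existsP; exists v; rewrite !eqxx. Qed.

(** The map [phi] numbers the points, first the [k] pairs and then the single vertices; [psi]
    represents a pair by its left vertex. The core consists of the hub [o], which is pair 0, and [K]
    pairs adjacent to it. *)
Lemma exists_inf_rigid (R : realType) (n m t d : nat) (hk : (2 * (14 * m) <= n)%N)
    (E : {set {set 'I_n}}) :
  (64 * t <= m)%N -> (64 <= m)%N -> (3 * m <= 2 ^ t)%N -> (d <= 7 * m)%N ->
  pairs_merge (7 * m) hk E -> singles_attach (6 * m) hk E -> pairs_dense m hk E ->
  exists q : 'M[R]_(n, d), inf_rigid (adj E) q.
Proof.
move=> tm m64 m3 d7 /forallP hmerge /forallP hatt /forallP hdense.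
set k := (14 * m)%N in hk hmerge hatt hdense *.
pose K := (13 * m).-1.
have phiP (v : 'I_n) : ((if v < k then v : nat else v - k) < n - k)%N.
  by case: (ltnP v k) => vk; have := ltn_ord v; lia.
pose phi v : 'I_(n - k) := Ordinal (phiP v).
have phiS (v : 'I_n) : (2 * k <= v)%N -> (phi v : nat) = (v - k)%N.
  by move=> vk; rewrite /= ifF //; lia.
have psiP (i : 'I_(n - k)) : ((if i < k then i : nat else i + k) < n)%N.
  by case: (ltnP i k) => vk; have := ltn_ord i; lia.
pose psi i : 'I_n := Ordinal (psiP i).
have psiK : cancel psi phi.
  move=> i; apply: val_inj => /=; case: (ltnP i k) => ik; first by rewrite ik.
  by rewrite ifF; lia.
have clsP (j : 'I_k) : (j < n - k)%N by have := ltn_ord j; lia.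
pose cls j : 'I_(n - k) := Ordinal (clsP j).
have cls_inj : injective cls by move=> i j /(congr1 val) /= /val_inj.
have phiL j : phi (pairL hk j) = cls j by apply: val_inj; rewrite /= ltn_ord.
have phiR j : phi (pairR hk j) = cls j.
  by apply: val_inj; rewrite /= ifF; have := ltn_ord j; lia.
have psiL j : psi (cls j) = pairL hk j by apply: val_inj; rewrite /= ltn_ord.
pose ca := classadj E phi.
have caL (s : 'I_n) j : adj E s (pairL hk j) || adj E s (pairR hk j) -> ca (phi s) (cls j).
  by case/orP => h; [rewrite -phiL|rewrite -phiR]; exact: classadjI.
have dense (i : 'I_k) : (#|[set j : 'I_k | (j != i) && ~~ ca (cls i) (cls j)]| <= m)%N.
  apply: leq_trans (hdense i); apply: subset_leq_card; apply/fintype.subsetP => j.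
  rewrite !inE => /andP[ji nca]; apply/and5P; split; first exact: ji.
  - apply: contra nca => h; by rewrite -(phiL i); apply: caL; rewrite h.
  - apply: contra nca => h; by rewrite -(phiL i); apply: caL; rewrite h orbT.
  - apply: contra nca => h; by rewrite -(phiR i); apply: caL; rewrite h.
  - apply: contra nca => h; by rewrite -(phiR i); apply: caL; rewrite h orbT.
have k_gt0 : (0 < k)%N by rewrite /k; lia.
pose o : 'I_k := Ordinal k_gt0.
(* Of the [14 * m - 1] pairs other than the hub, at most [m] are not adjacent to it. *)
have [g ginj hg] : exists2 g : 'I_K -> 'I_k, injective g &
    forall u, g u \in [set j | (j != o) && ca (cls o) (cls j)].
  apply: exists_injection_in.
  have := dense o; have := cardsC1 o; rewrite card_ord.
  have -> : [set~ o] = [set j | (j != o) && ca (cls o) (cls j)] :|: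
                     [set j | (j != o) && ~~ ca (cls o) (cls j)].
    by apply/setP => j; rewrite !inE; case: (j == o); case: (ca _ _).
  move=> hc; have [+ _] := leq_card_setU [set j | (j != o) && ca (cls o) (cls j)] [set j | (j != o) && ~~ ca (cls o) (cls j)].
  rewrite hc; set a := #|_|; set b := #|_| => h1 h2; rewrite /K; move: (a) (b) h1 h2 => x y; rewrite /k; lia.
pose h (i : 'I_(1 + K)) : 'I_(n - k) :=
  cls (match fintype.split i with inl _ => o | inr u => g u end).
have h0 : h ord0 = cls o by rewrite /h; case: splitP.
have hS u : h (rshift 1 u) = cls (g u).
  by rewrite /h; case: splitP => [j /= e|j /= [/val_inj ->]//]; have := ltn_ord j; lia.
have h_inj : injective h.
  move=> i j /cls_inj; rewrite -{2}[i]splitK -{2}[j]splitK.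
  case: (fintype.split i) => u; case: (fintype.split j) => v //=.
  - by rewrite !ord1.
  - by move=> e; have := hg v; rewrite inE -e eqxx.
  - by move=> e; have := hg u; rewrite inE e eqxx.
  - by move/ginj ->.
have hcls i : exists j, h i = cls j by rewrite /h; case: fintype.split; eexists.
pose H : rel 'I_K := fun u v => (u != v) && ~~ ca (cls (g u)) (cls (g v)).
have [q rq] : exists q : 'M[R]_(1 + K, d), inf_rigid (fun i j => ca (h i) (h j)) q.
  apply: (@cone_inf_rigid R (3 * m).-1 K d H).
  - by move=> u v; rewrite /H eq_sym /ca classadjC.
  - by move=> u; rewrite /H eqxx.
  - by move=> u; rewrite h0 hS; have := hg u; rewrite inE => /andP[].
  - by move=> u v uv; rewrite /H uv negbK !hS.
  - by rewrite /K; lia.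
  have [e1 e2 e3] := core_exponents tm m64 m3.
  apply: (exists_nonisotropic (D := m) (M := (K * m)./2) (e := ((9 * m - 3) %/ 4)%N)).
  - by move=> u v; rewrite /H eq_sym /ca classadjC.
  - by move=> u; rewrite /H eqxx.
  - move=> u; apply: leq_trans (dense (g u)); rewrite -(card_imset _ ginj).
    apply: subset_leq_card; apply/fintype.subsetP => j /imsetP [v]; rewrite !inE => /andP[uv nc] ->.
    by rewrite nc andbT (inj_eq ginj) eq_sym.
  - by rewrite -[X in (X <= _)%N]odd_double_half; case: odd; lia.
  - by lia.
  - exact: e1.
  - by rewrite card_Fp.
  - by rewrite card_Fp.
apply: (inf_rigid_classes psiK _ h_inj rq).
  move=> u; have [e|ne] := eqVneq u (psi (phi u)).
    have [f finj hf] : exists2 f : 'I_d -> 'I_(n - k), injective f & forall j, f j \in [set~ phi u].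
      by apply: exists_injection_in; rewrite cardsC1 card_ord /k; lia.
    by exists f => // j; split; [have := hf j; rewrite !inE|left].
  (* Left vertices and single vertices represent themselves, so [u] is the right vertex of a
     pair. *)
  have [i ui] : exists i, u = pairR hk i.
    have nk : (k <= u)%N.
      rewrite leqNgt; apply: contraNN ne => uk.
      by apply/eqP/val_inj; rewrite /= uk uk.
    have uk : (u - k < k)%N.
      rewrite ltnNge; apply: contraNN ne => uk.
      apply/eqP/val_inj; rewrite /= [(u < k)%N]ltnNge nk /= ltnNge uk /= subnK //.
    by exists (Ordinal uk); apply: val_inj; rewrite /= subnK.
  rewrite ui phiR psiL.
  pose S1 := [set j : 'I_k | (j != i) && (common hk E i (pairL hk j) || common hk E i (pairR hk j))].
  pose S2 := [set s : 'I_n | (2 * k <= s)%N && common hk E i s].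
  have phi_inj2 : {in S2 &, injective phi}.
    move=> s s'; rewrite !inE => /andP[s1 _] /andP[s2 _] /(congr1 val).
    rewrite -[LHS]/(phi s : nat) -[RHS]/(phi s' : nat) !phiS // => ess.
    by apply: val_inj => /=; lia.
  have [f finj hf] : exists2 f : 'I_d -> 'I_(n - k), injective f &
      forall j, f j \in cls @: S1 :|: phi @: S2.
    apply: exists_injection_in; apply: leq_trans d7 _; apply: leq_trans (hmerge i) _.
    rewrite cardsU (card_imset _ cls_inj) (card_in_imset phi_inj2) -/S1 -/S2.
    suff -> : cls @: S1 :&: phi @: S2 = finset.set0 by rewrite cards0 subn0.
    apply/setP => x; rewrite !inE; apply/negP => /andP[/imsetP[j _ ->] /imsetP[s]].
    rewrite inE => /andP[s1 _] /(congr1 val); rewrite -[RHS]/(phi s : nat) phiS //= => ejs.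
    by have := ltn_ord j; lia.
  exists f => // j; have := hf j; rewrite inE => /orP[/imsetP[x xS ->]|/imsetP[s sS ->]].
    move: xS; rewrite inE => /andP[xi cx]; split; first by rewrite (inj_eq cls_inj).
    right; case/orP: cx => /andP[c1 c2]; [exists (pairL hk x)|exists (pairR hk x)];
      by split; rewrite ?phiL ?phiR.
  move: sS; rewrite inE => /andP[s1 /andP[c1 c2]]; split; last by right; exists s.
  apply/eqP => /(congr1 val); rewrite -[LHS]/(phi s : nat) phiS //= => ejs.
  by have := ltn_ord i; lia.
move=> i hi.
pose A := [set u : 'I_(1 + K) | ca i (h u)].
have [f finj hf] : exists2 f : 'I_d -> 'I_(1 + K), injective f & forall j, f j \in A.
  apply: exists_injection_in.
  have cA : #|~: A| = (1 + K - #|A|)%N by rewrite cardsCs finset.setCK card_ord.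
  (* The core has [13 * m] points, so [7 * m >= d] remain. For a pair outside the core the density
     bound [m] suffices; for a single vertex the bound is [singles_attach]. *)
  suff cA6 : (#|~: A| <= 6 * m)%N by move: cA6; rewrite cA /K; lia.
  pose h' (u : 'I_(1 + K)) : 'I_k := match fintype.split u with inl _ => o | inr v => g v end.
  have h'_inj : injective h' by move=> x y e; apply: h_inj; rewrite /h -!/(h' _) e.
  rewrite -(card_imset _ h'_inj).
  have [ik|ik] := ltnP i k.
    have [j ij] : exists j, i = cls j by exists (Ordinal ik); apply: val_inj.
    apply: leq_trans (leq_trans (dense j) _); last lia.
    apply: subset_leq_card; apply/fintype.subsetP => x /imsetP[u]; rewrite !inE => nc ->.
    have := hi u; rewrite /h -/(h' u) ij (inj_eq cls_inj) => -> /=.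
    by move: nc; rewrite /h -/(h' u) ij.
  have sP : (i + k < n)%N by have := ltn_ord i; lia.
  pose s := Ordinal sP.
  have si : phi s = i by apply: val_inj => /=; rewrite ifF; lia.
  have := hatt s; rewrite (_ : (2 * k <= s)%N) /=; last by lia.
  apply: leq_trans; apply: subset_leq_card; apply/fintype.subsetP => x /imsetP[u].
  rewrite !inE => nc ->; rewrite -negb_or; apply: contra nc => /caL.
  by rewrite si /h -/(h' u).
by exists f => // j; have := hf j; rewrite inE.
Qed.

(** * Tail bounds for the random graph *)

Definition mean (R : realFieldType) (T : finType) (Om : {set T}) (f : {set T} -> R) : R :=
  (\sum_(E in powerset Om) f E) / #|powerset Om|%:R.

Lemma card_powerset_neq0 (R : realFieldType) (T : finType) (Om : {set T}) :
  #|powerset Om|%:R != 0 :> R.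
Proof. by rewrite pnatr_eq0 card_powerset -lt0n expn_gt0. Qed.

Lemma mean_cst (R : realFieldType) (T : finType) (Om : {set T}) (c : R) :
  mean Om (fun=> c) = c.
Proof. by rewrite /mean sumr_const -[c *+ _]mulr_natr mulfK // card_powerset_neq0. Qed.

Lemma eq_mean (R : realFieldType) (T : finType) (Om : {set T}) (f g : {set T} -> R) :
  f =1 g -> mean Om f = mean Om g.
Proof. by move=> fg; rewrite /mean; under eq_bigr do rewrite fg. Qed.

Lemma mean_le (R : realFieldType) (T : finType) (Om : {set T}) (f g : {set T} -> R) :
  (forall E, E \in powerset Om -> f E <= g E) -> mean Om f <= mean Om g.
Proof. by move=> fg; rewrite /mean ler_wpM2r ?invr_ge0 ?ler0n // ler_sum. Qed.

Lemma meanD (R : realFieldType) (T : finType) (Om : {set T}) (f g : {set T} -> R) :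
  mean Om (fun E => f E + g E) = mean Om f + mean Om g.
Proof. by rewrite /mean big_split mulrDl. Qed.

Lemma meanZ (R : realFieldType) (T : finType) (Om : {set T}) (c : R) (f : {set T} -> R) :
  mean Om (fun E => c * f E) = c * mean Om f.
Proof. by rewrite /mean -mulr_sumr mulrA. Qed.

(* Exchanging the parts outside [B] of two independent samples preserves their joint law. *)
Lemma mean_indep (R : realFieldType) (T : finType) (Om B : {set T}) (f g : {set T} -> R) :
  (forall E, f E = f (E :&: B)) -> (forall E, g E = g (E :\: B)) ->
  mean Om (fun E => f E * g E) = mean Om f * mean Om g.
Proof.
move=> fB gB; rewrite /mean; set P := powerset Om; set N := #|P|%:R.
have N0 : N != 0 by apply: card_powerset_neq0.
pose sw (p : {set T} * {set T}) :=
  ((p.1 :&: B) :|: (p.2 :\: B), (p.2 :&: B) :|: (p.1 :\: B)).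
have swK : involutive sw.
  move=> [E E']; rewrite /sw /=; congr (_, _); apply/setP => x; rewrite !inE;
    by case: (x \in B); case: (x \in E); case: (x \in E').
have swP p : (sw p \in finset.setX P P) = (p \in finset.setX P P).
  have imp q : q \in finset.setX P P -> sw q \in finset.setX P P.
    case: q => E E'; rewrite !inE /= => /andP[h h'].
    have sI (A : {set T}) : A \subset Om -> A :&: B \subset Om.
      exact/fintype.subset_trans/finset.subsetIl.
    have sD (A : {set T}) : A \subset Om -> A :\: B \subset Om.
      exact/fintype.subset_trans/finset.subsetDl.
    by rewrite !finset.subUset !sI ?sD.
  by apply/idP/idP => [/imp|/imp //]; rewrite swK.
have key : (\sum_(E in P) f E) * (\sum_(E in P) g E) = N * \sum_(E in P) f E * g E.
  transitivity (\sum_(p in finset.setX P P) f p.1 * g p.2).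
    rewrite big_distrl /=; under eq_bigr do rewrite big_distrr /=.
    by rewrite pair_big /=; apply: eq_bigl => -[E1 E2]; rewrite finset.in_setX.
  transitivity (\sum_(p in finset.setX P P) f (sw p).1 * g (sw p).1).
    apply: eq_bigr => -[E E'] _ /=; rewrite fB gB [f (_ :|: _)]fB [g (_ :|: _)]gB.
    congr (f _ * g _); apply/setP => x; rewrite !inE;
    by case: (x \in B); case: (x \in E); case: (x \in E').
  rewrite (reindex_inj (inv_inj swK)).
  under eq_bigl do rewrite swP; under eq_bigr do rewrite swK.
  transitivity (\sum_(E in P) \sum_(E' in P) f E * g E).
    by rewrite pair_big /=; apply: eq_bigl => -[E1 E2]; rewrite finset.in_setX.
  rewrite mulr_sumr; apply: eq_bigr => E _.
  by rewrite sumr_const -[_ *+ _]mulr_natl.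
by rewrite mulf_div key; field.
Qed.

Lemma mean_prod (R : realFieldType) (T : finType) (Om : {set T}) (J : eqType) (s : seq J)
    (B : J -> {set T}) (g : J -> {set T} -> R) :
  uniq s -> (forall j E, g j E = g j (E :&: B j)) ->
  (forall i j, i != j -> [disjoint B i & B j]) ->
  mean Om (fun E => \prod_(j <- s) g j E) = \prod_(j <- s) mean Om (g j).
Proof.
move=> us gB dB; elim: s us => [|j s IH] /=.
  by move=> _; under eq_mean do rewrite big_nil; rewrite mean_cst big_nil.
move=> /andP[js /IH eqs]; rewrite big_cons -eqs -(@mean_indep _ _ _ (B j)).
- by apply: eq_mean => E; rewrite big_cons.
- exact: gB.
move=> E; rewrite [LHS]big_seq [RHS]big_seq; apply: eq_bigr => i is_; rewrite gB [RHS]gB.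
congr (g i _); apply/setP => x; rewrite !inE.
case xi : (x \in B i); last by rewrite !andbF.
have ij : i != j by apply: contraNneq js => <-.
by rewrite (disjointFr (dB _ _ ij) xi).
Qed.

(** Conditioning on [e]: toggling [e] is an involution on the subsets of [Om], so both cases have
    probability 1/2, and [F b] is independent of them. *)
Lemma mean_edge (R : realFieldType) (T : finType) (Om : {set T}) (e : T)
    (F : bool -> {set T} -> R) :
  e \in Om -> (forall b E, F b E = F b (E :\ e)) ->
  mean Om (fun E => F (e \in E) E) = (mean Om (F true) + mean Om (F false)) / 2%:R.
Proof.
move=> eO Fe.
pose g (b : bool) (E : {set T}) : R := ((e \in E) == b)%:R.
have gE b E : g b E = g b (E :&: [set e]) by rewrite /g !inE eqxx andbT.
have -> : mean Om (fun E => F (e \in E) E) =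
          mean Om (fun E => g true E * F true E + g false E * F false E).
  by apply: eq_mean => E; rewrite /g; case: (e \in E); rewrite /= ?mul0r ?mul1r ?addr0 ?add0r.
rewrite meanD !(@mean_indep _ _ _ [set e]) //.
have tog b : mean Om (g b) = 2%:R^-1.
  have eqg : mean Om (g true) = mean Om (g false).
    rewrite /mean; congr (_ / _).
    pose tg (E : {set T}) := if e \in E then E :\ e else e |: E.
    have tgK : involutive tg.
      move=> E; rewrite /tg; case: (boolP (e \in E)) => eE.
        by rewrite !inE eqxx /= finset.setD1K.
      by rewrite !inE eqxx /= setU1K.
    rewrite (reindex_inj (inv_inj tgK)) /=; apply: eq_big => E.
      rewrite !inE /tg; case: (boolP (e \in E)) => eE.
        by rewrite -{2}(finset.setD1K eE) finset.subUset finset.sub1set eO.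
      by rewrite finset.subUset finset.sub1set eO.
    by move=> _; rewrite /g /tg; case: (boolP (e \in E)) => eE; rewrite !inE eqxx.
  have := mean_cst Om (1 : R); have -> : mean Om (fun=> (1 : R)) = mean Om (fun E => g true E + g false E).
    by apply: eq_mean => E; rewrite /g; case: (e \in E); rewrite /= ?addr0 ?add0r.
  rewrite meanD; case: b; [rewrite -eqg|rewrite eqg] => h; lra.
by rewrite !tog; field.
Qed.

Lemma mean_two_edges (R : realFieldType) (T : finType) (Om : {set T}) (e1 e2 : T)
    (F : bool -> bool -> R) :
  e1 \in Om -> e2 \in Om -> e1 != e2 ->
  mean Om (fun E => F (e1 \in E) (e2 \in E)) =
  (F true true + F true false + F false true + F false false) / 4%:R.
Proof.
move=> h1 h2 n12.
rewrite (@mean_edge _ _ _ e1 (fun b E => F b (e2 \in E))) //; last first.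
  by move=> b E; rewrite !inE eq_sym n12.
by rewrite !(@mean_edge _ _ _ e2 (fun b E => F _ b)) // !mean_cst; field.
Qed.

Lemma mean_four_edges (R : realFieldType) (T : finType) (Om : {set T}) (e1 e2 e3 e4 : T)
    (F : bool -> bool -> bool -> bool -> R) :
  {subset [:: e1; e2; e3; e4] <= Om} -> uniq [:: e1; e2; e3; e4] ->
  mean Om (fun E => F (e1 \in E) (e2 \in E) (e3 \in E) (e4 \in E)) =
  (\sum_(a : bool) \sum_(b : bool) \sum_(c : bool) \sum_(d : bool) F a b c d) / 16%:R.
Proof.
move=> sO /=; rewrite !inE !negb_or => /and4P[/and3P[n12 n13 n14] /andP[n23 n24] n34 _].
have [m1 m2 m3 m4] : [/\ e1 \in Om, e2 \in Om, e3 \in Om & e4 \in Om].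
  by split; apply: sO; rewrite !inE eqxx ?orbT.
rewrite (@mean_edge _ _ _ e1 (fun b E => F b (e2 \in E) (e3 \in E) (e4 \in E))) //; last first.
  by move=> b E; rewrite !inE ![_ == e1]eq_sym n12 n13 n14.
rewrite !(@mean_edge _ _ _ e2 (fun b E => F _ b (e3 \in E) (e4 \in E))) //; try
  by move=> b E; rewrite !inE ![_ == e2]eq_sym n23 n24.
by rewrite !mean_two_edges // !big_bool /=; field.
Qed.

(** * Independence of the edges towards a fixed vertex set *)

Definition cross (n : nat) (V U : {set 'I_n}) : {set {set 'I_n}} :=
  [set [set p.1; p.2]%SET | p in finset.setX V U].

Lemma mem_cross (n : nat) (V U : {set 'I_n}) (a x : 'I_n) :
  a \in V -> x \in U -> [set a; x]%SET \in cross V U.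
Proof. by move=> aV xU; apply/imsetP; exists (a, x) => //; rewrite finset.in_setX aV xU. Qed.

Lemma adj_cross (n : nat) (E : {set {set 'I_n}}) (V U : {set 'I_n}) (a x : 'I_n) :
  a \in V -> x \in U -> adj (E :&: cross V U) a x = adj E a x.
Proof. by move=> aV xU; rewrite /adj inE mem_cross // andbT. Qed.

Lemma set2_eq_cross (n : nat) (V U : {set 'I_n}) (a x a' x' : 'I_n) :
  [disjoint V & U] -> a \in V -> x \in U -> a' \in V -> x' \in U ->
  [set a; x]%SET = [set a'; x']%SET -> a = a' /\ x = x'.
Proof.
move=> dVU aV xU a'V x'U e.
have ne y z : y \in V -> z \in U -> y != z.
  by move=> yV zU; apply: contraTneq zU => <-; rewrite (disjointFr dVU yV).
have : a \in [set a'; x']%SET by rewrite -e !inE eqxx.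
rewrite !inE (negbTE (ne _ _ aV x'U)) orbF => /eqP; split=> //.
have : x \in [set a'; x']%SET by rewrite -e !inE eqxx orbT.
by rewrite !inE [x == a']eq_sym (negbTE (ne _ _ a'V xU)) => /eqP.
Qed.

Lemma disjoint_cross (n : nat) (V V' U : {set 'I_n}) :
  [disjoint V & V'] -> [disjoint V & U] -> [disjoint V' & U] ->
  [disjoint cross V U & cross V' U].
Proof.
move=> dVV dVU dVU'; apply/pred0P => e /=; apply/negP => /andP[/imsetP[[a x]]].
rewrite finset.in_setX /= => /andP[aV xU] -> /imsetP[[a' x']].
rewrite finset.in_setX /= => /andP[a'V x'U] e2.
have : a \in [set a'; x']%SET by rewrite -e2 !inE eqxx.
rewrite !inE => /orP[/eqP aa|/eqP ax].
  by move: a'V; rewrite -aa (disjointFr dVV aV).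
by move: x'U; rewrite -ax (disjointFr dVU aV).
Qed.

Lemma mean_prod_cross (R : realFieldType) (n : nat) (Om : {set {set 'I_n}}) (J : finType)
    (V : J -> {set 'I_n}) (U : {set 'I_n}) (g : J -> {set {set 'I_n}} -> R) :
  (forall i j, i != j -> [disjoint V i & V j]) -> (forall j, [disjoint V j & U]) ->
  (forall j E, g j E = g j (E :&: cross (V j) U)) ->
  mean Om (fun E => \prod_j g j E) = \prod_j mean Om (g j).
Proof.
move=> dV dU gB; apply: mean_prod gB _; first exact: index_enum_uniq.
by move=> i j ij; apply: disjoint_cross (dV _ _ ij) (dU _) (dU _).
Qed.

Lemma mem_pairs (n : nat) (a x : 'I_n) : a != x -> [set a; x]%SET \in pairs n.
Proof. by move=> ax; rewrite inE cards2 ax. Qed.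

Lemma mean_adj2 (R : realFieldType) (n : nat) (a a' x : 'I_n) (F : bool -> bool -> R) :
  uniq [:: a; a'; x] ->
  mean (pairs n) (fun E => F (adj E a x) (adj E a' x)) =
  (F true true + F true false + F false true + F false false) / 4%:R.
Proof.
rewrite /= !inE negb_or => /andP[/andP[aa ax] /andP[ax' _]].
apply: mean_two_edges; rewrite ?mem_pairs //.
apply: contraNneq aa => /(@set2_eq_cross _ [set a; a'] [set x]) []; rewrite ?inE ?eqxx ?orbT //.
  by apply/pred0P => y /=; rewrite !inE; apply/negP => /andP[/orP[/eqP ->|/eqP ->]];
    rewrite ?(negbTE ax) ?(negbTE ax').
by move=> ->; rewrite eqxx.
Qed.

Lemma mean_adj4 (R : realFieldType) (n : nat) (a a' x x' : 'I_n)
    (F : bool -> bool -> bool -> bool -> R) :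
  uniq [:: a; a'; x; x'] ->
  mean (pairs n) (fun E => F (adj E a x) (adj E a x') (adj E a' x) (adj E a' x')) =
  (\sum_(b1 : bool) \sum_(b2 : bool) \sum_(b3 : bool) \sum_(b4 : bool) F b1 b2 b3 b4) / 16%:R.
Proof.
rewrite /= !inE !negb_or => /and4P[/and3P[aa ax ax2] /andP[a2x a2x2] xx _].
have dj : [disjoint [set a; a'] & [set x; x']].
  by apply/pred0P => y /=; rewrite !inE; apply/negP => /andP[/orP[/eqP ->|/eqP ->]];
    rewrite ?(negbTE ax) ?(negbTE ax2) ?(negbTE a2x) ?(negbTE a2x2).
have ne b b' y y' : b \in [set a; a']%SET -> b' \in [set a; a']%SET ->
    y \in [set x; x']%SET -> y' \in [set x; x']%SET -> (b != b') || (y != y') ->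
    [set b; y]%SET != [set b'; y']%SET.
  move=> h1 h2 h3 h4; apply: contraTneq => /(set2_eq_cross dj h1 h3 h2 h4) [-> ->].
  by rewrite !eqxx.
apply: mean_four_edges => [e|].
  by rewrite !inE => /or4P[] /eqP ->; rewrite cards2 ?ax ?ax2 ?a2x ?a2x2.
by rewrite /= !inE !negb_or !ne ?inE ?eqxx ?orbT ?aa ?xx.
Qed.

Lemma chernoff_prod (R : realFieldType) (J : finType) (A : pred J) (l : R) :
  \prod_j (if A j then l else 1) = l ^+ #|[set j | A j]|.
Proof. by rewrite -big_mkcond -prodr_const /=; apply: eq_bigl => j; rewrite inE. Qed.

(** Markov's inequality for [l ^+ X], where [X] is the count; the power is written as a product so
    that independence applies. *)
Lemma chernoff_upper (R : realFieldType) (T J : finType) (Om : {set T})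
    (A : J -> {set T} -> bool) (l : R) (t : nat) :
  1 <= l ->
  mean Om (fun E => (t < #|[set j | A j E]|)%N%:R) <=
  mean Om (fun E => \prod_j (if A j E then l else 1)) / l ^+ t.
Proof.
move=> l1; have l0 : 0 < l by apply: lt_le_trans l1.
rewrite mulrC -meanZ; apply: mean_le => E _; rewrite (chernoff_prod (A ^~ E)) ler_pdivlMl ?exprn_gt0 //.
case: ltnP => [tX|_]; last by rewrite mulr0 exprn_ge0 // ltW.
by rewrite mulr1 ler_weXn2l // ltnW.
Qed.

Lemma chernoff_lower (R : realFieldType) (T J : finType) (Om : {set T})
    (A : J -> {set T} -> bool) (l : R) (t : nat) :
  0 < l <= 1 ->
  mean Om (fun E => (#|[set j | A j E]| < t)%N%:R) <=
  mean Om (fun E => \prod_j (if A j E then l else 1)) / l ^+ t.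
Proof.
move=> /andP[l0 l1].
rewrite mulrC -meanZ; apply: mean_le => E _; rewrite (chernoff_prod (A ^~ E)) ler_pdivlMl ?exprn_gt0 //.
case: ltnP => [tX|_]; last by rewrite mulr0 exprn_ge0 // ltW.
by rewrite mulr1; apply: ler_wiXn2l => //; [exact: ltW|exact: ltnW].
Qed.

Lemma mean_exists_le (R : realFieldType) (T I : finType) (Om : {set T})
    (P : I -> {set T} -> bool) (c : R) :
  (forall i, mean Om (fun E => (~~ P i E)%:R) <= c) ->
  mean Om (fun E => (~~ [forall i, P i E])%:R) <= #|I|%:R * c.
Proof.
move=> Pc; apply: le_trans (_ : mean Om (fun E => \sum_i (~~ P i E)%:R) <= _).
  apply: mean_le => E _; case: (boolP [forall i, P i E]) => [_|]; first by rewrite sumr_ge0.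
  rewrite negb_forall => /existsP [i nP]; rewrite (bigD1 i) //= nP lerDl sumr_ge0 //.
rewrite /mean exchange_big mulr_suml -[#|I|]sum1_card natr_sum mulr_suml.
by apply: ler_sum => i _; rewrite mul1r; exact: Pc.
Qed.

(** * Tail bounds for the three graph conditions *)

Definition pair_index (k v : nat) : nat := if (v < k)%N then v else (v - k)%N.

Lemma pair_indexL (n k : nat) (hk : (2 * k <= n)%N) (j : 'I_k) : pair_index k (pairL hk j) = j.
Proof. by rewrite /pair_index /= ltn_ord. Qed.

Lemma pair_indexR (n k : nat) (hk : (2 * k <= n)%N) (j : 'I_k) : pair_index k (pairR hk j) = j.
Proof. by rewrite /pair_index /= ltnNge leq_addl /= addnK. Qed.

Lemma pair_indexS (k v : nat) : (2 * k <= v)%N -> pair_index k v = (v - k)%N.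
Proof. by move=> kv; rewrite /pair_index ltnNge (_ : (k <= v)%N) //; lia. Qed.

Definition pairV (n k : nat) (hk : (2 * k <= n)%N) (j : 'I_k) : {set 'I_n} :=
  [set pairL hk j; pairR hk j]%SET.

Lemma pairV_index (n k : nat) (hk : (2 * k <= n)%N) (j : 'I_k) (x : 'I_n) :
  x \in pairV hk j -> pair_index k x = j.
Proof. by rewrite !inE => /orP[] /eqP ->; rewrite ?pair_indexL ?pair_indexR. Qed.

Lemma disjoint_by (T : finType) (f : T -> nat) (A B : {set T}) (c : nat) :
  (forall x, x \in A -> f x = c) -> (forall x, x \in B -> f x <> c) -> [disjoint A & B].
Proof. by move=> hA hB; apply/pred0P => x /=; apply/negP => /andP[/hA e /hB]. Qed.

Lemma disjoint_pairV (n k : nat) (hk : (2 * k <= n)%N) (i j : 'I_k) :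
  i != j -> [disjoint pairV hk i & pairV hk j].
Proof.
move=> ij; apply: (disjoint_by (f := fun x : 'I_n => pair_index k x) (c := i)) => x /pairV_index // -> e.
by move/eqP: ij; apply; apply: val_inj.
Qed.

Lemma uniq_two_pairs (n k : nat) (hk : (2 * k <= n)%N) (i j : 'I_k) :
  j != i -> uniq [:: pairL hk j; pairR hk j; pairL hk i; pairR hk i].
Proof.
move=> ji; have neq : (j : nat) <> i by move=> e; move/eqP: ji; apply; apply: val_inj.
have := ltn_ord i; have := ltn_ord j => jk ik.
rewrite /= !inE -!val_eqE /= !negb_or; lia.
Qed.

(** Another pair contains a common neighbour with probability 7/16 and a single vertex is one with
    probability 1/4. With [l = 31/32] the factors are [1 - 7/512] and [1 - 1/128]. The expected
    count, about [7.125 * m], barely exceeds the threshold. *)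
Lemma pairs_merge_tail (R : realFieldType) (n m : nat) (hk : (2 * (14 * m) <= n)%N) (i : 'I_(14 * m)) :
  (32 * m <= n)%N ->
  mean (pairs n) (fun E => (~~ (7 * m <= #|[set j : 'I_(14 * m) | (j != i) &&
       (common hk E i (pairL hk j) || common hk E i (pairR hk j))]| +
     #|[set s : 'I_n | (2 * (14 * m) <= s) && common hk E i s]|)%N)%:R : R)
  <= (505%:R / 512%:R) ^+ (14 * m).-1 * (127%:R / 128%:R) ^+ (4 * m) / (31%:R / 32%:R) ^+ (7 * m).
Proof.
move=> n32; set k := (14 * m)%N in hk i *; set l : R := 31%:R / 32%:R.
have l01 : 0 < l <= 1 by rewrite /l; apply/andP; split; lra.
(* The sum type merges both counts into one sum of independent indicators; excluded indices get an
   impossible event and, in [V], the empty vertex set. *)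
pose A (j : 'I_k + 'I_n) (E : {set {set 'I_n}}) : bool := match j with
  | inl j => (j != i) && (common hk E i (pairL hk j) || common hk E i (pairR hk j))
  | inr s => (2 * k <= s)%N && common hk E i s end.
have cA E : #|[set j | A j E]| = (#|[set j : 'I_k | (j != i) &&
       (common hk E i (pairL hk j) || common hk E i (pairR hk j))]| +
     #|[set s : 'I_n | (2 * k <= s)%N && common hk E i s]|)%N.
  by rewrite -!sum1dep_card big_mkcond big_sumType /= -!big_mkcond.
rewrite (_ : mean _ _ = mean (pairs n) (fun E => (#|[set j | A j E]| < 7 * m)%N%:R)); last first.
  by apply: eq_mean => E; rewrite cA ltnNge.
apply: le_trans (chernoff_lower _ _ _ l01) _.
rewrite ler_wpM2r ?invr_ge0 ?exprn_ge0 //; first by case/andP: l01 => /ltW.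
pose V (j : 'I_k + 'I_n) : {set 'I_n} := match j with
  | inl j => if j != i then pairV hk j else finset.set0
  | inr s => if (2 * k <= s)%N then [set s]%SET else finset.set0 end.
pose key (j : 'I_k + 'I_n) : nat := match j with inl j => j | inr s => (s - k)%N end.
have keyV j x : x \in V j -> pair_index k x = key j /\
    match j with inl j => j != i | inr s => (2 * k <= s)%N end.
  case: j => [j|s] /=; first by case: ifP => [ji /pairV_index //|_]; rewrite inE.
  by case: ifP => [sk|_]; rewrite inE // => /eqP ->; rewrite pair_indexS.
rewrite (@mean_prod_cross R n (pairs n) _ V (pairV hk i)); last first.
- move=> [j|s] E /=; last first.
    case: (boolP (2 * k <= s)%N) => //= sk.
    by rewrite /common !adj_cross ?inE ?eqxx ?orbT.
  case: (boolP (j != i)) => //= ji.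
  by rewrite /common !adj_cross ?inE ?eqxx ?orbT.
- move=> j; apply/pred0P => x /=; apply/negP => /andP[/keyV [e c] /pairV_index]; rewrite e.
  case: j c {e} => [j ji|s sk] /= e; last by have := ltn_ord i; lia.
  by move/eqP: ji; apply; apply: val_inj.
- move=> j j' jj; apply/pred0P => x /=; apply/negP => /andP[/keyV [e c] /keyV [e' c']].
  move: e'; rewrite e => {e} ek; move/eqP: jj; apply; move: ek.
  case: j c => [j|s] c; case: j' c' => [j'|s'] c' /= e.
  - by congr inl; apply: val_inj.
  - by have := ltn_ord j; lia.
  - by have := ltn_ord j'; lia.
  - by congr inr; apply: val_inj => /=; lia.
rewrite big_sumType /=; apply: ler_pM.
- by apply: prodr_ge0 => j _; rewrite mulr_ge0 ?invr_ge0 ?ler0n // sumr_ge0 // => E _; case: ifP => _; case/andP: l01 => /ltW.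
- by apply: prodr_ge0 => j _; rewrite mulr_ge0 ?invr_ge0 ?ler0n // sumr_ge0 // => E _; case: ifP => _; case/andP: l01 => /ltW.
- have -> : (505%:R / 512%:R : R) ^+ k.-1 = \prod_(j < k) (if j != i then 505%:R / 512%:R else 1).
    by rewrite -big_mkcond prodr_const /= cardC1 card_ord.
  apply: ler_prod => j _; rewrite mulr_ge0 ?invr_ge0 ?ler0n ?sumr_ge0 //=; last first.
    by move=> E _; case: ifP => _; case/andP: l01 => /ltW.
  case: (boolP (j != i)) => ji /=; last by rewrite mean_cst.
  rewrite (mean_adj4 (fun b1 b2 b3 b4 => if b1 && b2 || b3 && b4 then l else 1) (uniq_two_pairs hk ji)).
  rewrite !big_bool /= /l; lra.
(* At least [4 * m] vertices are single because [32 * m <= n]; more of them only decrease the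
   product. *)
apply: le_trans (_ : \prod_(s < n) (if (2 * k <= s)%N then 127%:R / 128%:R else 1) <= _).
  apply: ler_prod => s _; rewrite mulr_ge0 ?invr_ge0 ?ler0n ?sumr_ge0 //=; last first.
    by move=> E _; case: ifP => _; case/andP: l01 => /ltW.
  case: (boolP (2 * k <= s)%N) => sk /=; last by rewrite mean_cst.
  have h : mean (pairs n) (fun E => if common hk E i s then l else 1) =
      mean (pairs n) (fun E => (fun b b' => if b && b' then l else 1) (adj E (pairL hk i) s) (adj E (pairR hk i) s)).
    by apply: eq_mean => E; rewrite /common /= ![adj E s _]adjC.
  have us : uniq [:: pairL hk i; pairR hk i; s].
    by have := ltn_ord i; rewrite /= !inE -!val_eqE /=; lia.
  by rewrite h (mean_adj2 (fun b b' => if b && b' then l else 1) us) /= /l; lra.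
rewrite -big_mkcond /= prodr_const.
apply: ler_wiXn2l; [lra|lra|].
have fP (s : 'I_(4 * m)) : (s + 2 * k < n)%N by have := ltn_ord s; rewrite /k; lia.
pose f s : 'I_n := Ordinal (fP s).
have finj : injective f by move=> s s1 /(congr1 val) /= /addIn /val_inj.
rewrite -[(4 * m)%N]card_ord -(fintype.card_image finj); apply: subset_leq_card.
by apply/fintype.subsetP => x /fintype.imageP [s _ ->]; apply: leq_addl.
Qed.

Lemma mean_ge0 (R : realFieldType) (T : finType) (Om : {set T}) (f : {set T} -> R) :
  (forall E, 0 <= f E) -> 0 <= mean Om f.
Proof. by move=> f0; rewrite mulr_ge0 ?invr_ge0 ?ler0n // sumr_ge0. Qed.

(** A pair is missed with probability 1/4, so [l = 2] gives the factor [1 + 1/4]. For a vertex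
    inside a pair the implication is vacuous. *)
Lemma singles_attach_tail (R : realFieldType) (n m : nat) (hk : (2 * (14 * m) <= n)%N) (s : 'I_n) :
  mean (pairs n) (fun E => (~~ ((2 * (14 * m) <= s)%N ==>
    (#|[set j : 'I_(14 * m) | ~~ adj E s (pairL hk j) && ~~ adj E s (pairR hk j)]| <= 6 * m)%N))%:R : R)
  <= (5%:R / 4%:R) ^+ (14 * m) / 2%:R ^+ (6 * m).
Proof.
set k := (14 * m)%N in hk *.
have [sk|sk] := boolP (2 * k <= s)%N; last first.
  rewrite (_ : mean _ _ = 0); last by rewrite -[RHS](mean_cst (pairs n) 0).
  by rewrite mulr_ge0 ?invr_ge0 ?exprn_ge0 //; lra.
pose A (j : 'I_k) (E : {set {set 'I_n}}) := ~~ adj E s (pairL hk j) && ~~ adj E s (pairR hk j).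
rewrite (_ : mean _ _ = mean (pairs n) (fun E => (6 * m < #|[set j | A j E]|)%N%:R)); last first.
  by apply: eq_mean => E; rewrite /= -ltnNge.
apply: le_trans (chernoff_upper _ _ _ (_ : 1 <= 2%:R)) _; first lra.
rewrite ler_wpM2r ?invr_ge0 ?exprn_ge0 //.
rewrite (@mean_prod_cross R n (pairs n) _ (pairV hk) [set s]%SET); last first.
- by move=> j E /=; rewrite /A ![adj _ s _]adjC !adj_cross ?inE ?eqxx ?orbT.
- move=> j; apply/pred0P => x /=; apply/negP => /andP[/pairV_index e].
  by rewrite inE => /eqP xs; move: e; rewrite xs pair_indexS //; have := ltn_ord j; lia.
- by move=> i j; exact: disjoint_pairV.
rewrite -[X in _ ^+ X]card_ord -prodr_const; apply: ler_prod => j _.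
apply/andP; split; first by apply: mean_ge0 => E; case: ifP => _; lra.
have us : uniq [:: pairL hk j; pairR hk j; s].
  by have := ltn_ord j; rewrite /= !inE -!val_eqE /=; lia.
rewrite (_ : mean _ _ = mean (pairs n) (fun E => (fun b b' => if ~~ b && ~~ b' then 2%:R else 1)
    (adj E (pairL hk j) s) (adj E (pairR hk j) s))); last first.
  by apply: eq_mean => E; rewrite /A /= ![adj E s _]adjC.
by rewrite (mean_adj2 (fun b b' => if ~~ b && ~~ b' then 2%:R else 1) us) /=; lra.
Qed.

(** Four absent edges have probability 1/16, so [l = 8/7] gives the factor [1 + 1/112]; the index
    [i] contributes 1. *)
Lemma pairs_dense_tail (R : realFieldType) (n m : nat) (hk : (2 * (14 * m) <= n)%N) (i : 'I_(14 * m)) :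
  mean (pairs n) (fun E => (~~ (#|[set j : 'I_(14 * m) | (j != i) &&
     [&& ~~ adj E (pairL hk i) (pairL hk j), ~~ adj E (pairL hk i) (pairR hk j),
         ~~ adj E (pairR hk i) (pairL hk j) & ~~ adj E (pairR hk i) (pairR hk j)]]| <= m)%N)%:R : R)
  <= (113%:R / 112%:R) ^+ (14 * m) / (8%:R / 7%:R) ^+ m.
Proof.
set k := (14 * m)%N in hk i *; set l : R := 8%:R / 7%:R.
have l1 : 1 <= l by rewrite /l; lra.
pose A (j : 'I_k) (E : {set {set 'I_n}}) := (j != i) &&
     [&& ~~ adj E (pairL hk i) (pairL hk j), ~~ adj E (pairL hk i) (pairR hk j),
         ~~ adj E (pairR hk i) (pairL hk j) & ~~ adj E (pairR hk i) (pairR hk j)].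
rewrite (_ : mean _ _ = mean (pairs n) (fun E => (m < #|[set j | A j E]|)%N%:R)); last first.
  by apply: eq_mean => E; rewrite /= -ltnNge.
apply: le_trans (chernoff_upper _ _ _ l1) _.
rewrite ler_wpM2r ?invr_ge0 ?exprn_ge0 //; first by rewrite (le_trans _ l1).
pose V (j : 'I_k) := if j != i then pairV hk j else finset.set0.
rewrite (@mean_prod_cross R n (pairs n) _ V (pairV hk i)); last first.
- move=> j E /=; rewrite /A /V; case: (boolP (j != i)) => //= ji.
  by rewrite ![adj _ (_ hk i) _]adjC !adj_cross ?inE ?eqxx ?orbT.
- move=> j; rewrite /V; case: ifP => [ji|_]; first exact: disjoint_pairV.
  by apply/pred0P => x; rewrite /= inE.
- move=> j j' jj; rewrite /V; case: ifP => [ji|_]; last by apply/pred0P => x; rewrite /= inE.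
  case: ifP => [j'i|_]; first exact: disjoint_pairV.
  by apply/pred0P => x; rewrite /= finset.in_set0 andbF.
rewrite -[X in _ ^+ X]card_ord -prodr_const; apply: ler_prod => j _.
apply/andP; split; first by apply: mean_ge0 => E; case: ifP => _; lra.
rewrite /A; case: (boolP (j != i)) => ji /=; last by rewrite mean_cst; lra.
rewrite (_ : mean _ _ = mean (pairs n) (fun E => (fun b1 b2 b3 b4 =>
    if [&& ~~ b1, ~~ b2, ~~ b3 & ~~ b4] then l else 1)
    (adj E (pairL hk j) (pairL hk i)) (adj E (pairL hk j) (pairR hk i))
    (adj E (pairR hk j) (pairL hk i)) (adj E (pairR hk j) (pairR hk i)))); last first.
  apply: eq_mean => E /=; rewrite ![adj _ (_ hk i) _]adjC.
  by case: (adj E (pairL hk j) (pairL hk i)) => //=; rewrite andbCA.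
rewrite (mean_adj4 (fun b1 b2 b3 b4 => if [&& ~~ b1, ~~ b2, ~~ b3 & ~~ b4] then l else 1)
  (uniq_two_pairs hk ji)).
by rewrite !big_bool /= /l; lra.
Qed.

Definition good_graph (n m : nat) (hk : (2 * (14 * m) <= n)%N) (E : {set {set 'I_n}}) : bool :=
  [&& pairs_merge (7 * m) hk E, singles_attach (6 * m) hk E & pairs_dense m hk E].

(** Taking the [m]-th power out and clearing denominators leaves an inequality between explicit
    integers. *)
Lemma frac_pow_le (R : realFieldType) (m i1 i2 i3 : nat) (a b c d e f p q : nat) :
  (0 < b)%N -> (0 < d)%N -> (0 < e)%N -> (0 < f)%N -> (0 < q)%N ->
  (a ^ i1 * c ^ i2 * f ^ i3 * q <= p * e ^ i3 * b ^ i1 * d ^ i2)%N ->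
  ((a%:R / b%:R) ^+ i1 * (c%:R / d%:R) ^+ i2) ^+ m / ((e%:R / f%:R) ^+ i3) ^+ m
    <= (p%:R / q%:R) ^+ m :> R.
Proof.
move=> b0 d0 e0 f0 q0; rewrite -(ler_nat R) !natrM !natrX => h.
have [B D EE FF] : [/\ 0 < b%:R :> R, 0 < d%:R :> R, 0 < e%:R :> R & 0 < f%:R :> R].
  by rewrite !ltr0n.
have Q : 0 < q%:R :> R by rewrite ltr0n.
have u0 : 0 <= (a%:R / b%:R) ^+ i1 * (c%:R / d%:R) ^+ i2 :> R.
  by rewrite mulr_ge0 // exprn_ge0 // divr_ge0 // ler0n.
have v0 : 0 < (e%:R / f%:R) ^+ i3 :> R by rewrite exprn_gt0 // divr_gt0.
suff uv : (a%:R / b%:R) ^+ i1 * (c%:R / d%:R) ^+ i2 <= p%:R / q%:R * (e%:R / f%:R) ^+ i3 :> R.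
  by rewrite ler_pdivrMr ?(exprn_gt0 m v0) // -exprMn lerXn2r // nnegrE (le_trans u0 uv).
rewrite !expr_div_n !mulf_div ler_pdivrMr ?mulr_gt0 ?exprn_gt0 // mulrAC.
rewrite ler_pdivlMr ?mulr_gt0 ?exprn_gt0 //.
by move: h; rewrite -subr_ge0 => h; rewrite -subr_ge0; apply: le_trans h _; rewrite le_eqVlt; apply/orP; left; apply/eqP; ring.
Qed.

Lemma merge_numerics :
  (505 ^ 14 * 127 ^ 4 * 32 ^ 7 * 1000 <= 999 * 31 ^ 7 * 512 ^ 14 * 128 ^ 4)%N.
Proof. lia. Qed.

Lemma attach_numerics : (5 ^ 14 * 1 ^ 0 * 1 ^ 6 * 1000 <= 999 * 2 ^ 6 * 4 ^ 14 * 1 ^ 0)%N.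
Proof. lia. Qed.

Lemma dense_numerics : (113 ^ 14 * 1 ^ 0 * 7 ^ 1 * 1000 <= 999 * 8 ^ 1 * 112 ^ 14 * 1 ^ 0)%N.
Proof. lia. Qed.

(* The left-hand sides come from Chernoff's bound with parameters [31/32], [2] and [8/7]. *)
Lemma tail_numerics (R : realFieldType) (m : nat) :
  (0 < m)%N ->
  [/\ (505%:R / 512%:R) ^+ (14 * m).-1 * (127%:R / 128%:R) ^+ (4 * m) / (31%:R / 32%:R) ^+ (7 * m)
        <= 2%:R * (999%:R / 1000%:R) ^+ m :> R,
      (5%:R / 4%:R) ^+ (14 * m) / 2%:R ^+ (6 * m) <= (999%:R / 1000%:R) ^+ m :> R &
      (113%:R / 112%:R) ^+ (14 * m) / (8%:R / 7%:R) ^+ m <= (999%:R / 1000%:R) ^+ m :> R].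
Proof.
move=> m0; have a0 : 0 < 505%:R / 512%:R :> R by lra.
have t1 := @frac_pow_le R m 14 4 7 505 512 127 128 31 32 999 1000 isT isT isT isT isT merge_numerics.
have t2 := @frac_pow_le R m 14 0 6 5 4 1 1 2 1 999 1000 isT isT isT isT isT attach_numerics.
have t3 := @frac_pow_le R m 14 0 1 113 112 1 1 8 7 999 1000 isT isT isT isT isT dense_numerics.
rewrite expr0 mulr1 -!exprM divr1 in t2; rewrite expr0 mulr1 -!exprM mul1n in t3.
rewrite -!exprM in t1; split.
(* Multiplication by 505/512 completes the exponent to [14 * m]; the factor 2 on the right outweighs
   it. *)
- rewrite -(ler_pM2l a0) !mulrA -exprS prednK; last by lia.
  move: t1; rewrite exprMn -!exprM => /le_trans; apply.
  rewrite -[X in X <= _]mul1r ler_wpM2r ?exprn_ge0 ?divr_ge0 ?ler0n //.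
  by rewrite mulrAC ler_pdivlMr ?ltr0n // mul1r -natrM ler_nat.
- exact: t2.
- exact: t3.
Qed.

Lemma good_graph_tail (R : realFieldType) (n m : nat) (hk : (2 * (14 * m) <= n)%N) :
  (32 * m <= n)%N -> (0 < m)%N ->
  mean (pairs n) (fun E => (~~ good_graph hk E)%:R : R) <= 4%:R * n%:R * (999%:R / 1000%:R) ^+ m.
Proof.
move=> n32 m0; set rho := _ ^+ m.
have rho0 : 0 <= rho by apply: exprn_ge0; lra.
have [t1 t2 t3] := tail_numerics R m0; rewrite -/rho in t1 t2 t3.
have h1 := mean_exists_le (fun i => le_trans (pairs_merge_tail R hk i n32) t1).
have h2 := mean_exists_le (fun s => le_trans (singles_attach_tail R hk s) t2).
have h3 := mean_exists_le (fun i => le_trans (pairs_dense_tail R hk i) t3).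
rewrite !card_ord in h1 h2 h3; clear t1 t2 t3.
apply: le_trans (_ : mean (pairs n) (fun E => (~~ pairs_merge (7 * m) hk E)%:R +
   ((~~ singles_attach (6 * m) hk E)%:R + (~~ pairs_dense m hk E)%:R)) <= _).
  apply: mean_le => E _; rewrite /good_graph.
  by case: pairs_merge; case: singles_attach; case: pairs_dense; rewrite /=; lra.
rewrite !meanD; have kn : (14 * m)%:R * 2%:R <= n%:R :> R by rewrite -natrM ler_nat mulnC.
have k0 : 0 <= (14 * m)%:R :> R by rewrite ler0n.
have := lerD h1 (lerD h2 h3); move/le_trans; apply.
have : (14 * m)%:R * 2%:R * rho <= n%:R * rho by rewrite ler_wpM2r.
have : 0 <= (14 * m)%:R * rho by rewrite mulr_ge0.
have : 0 <= n%:R * rho by rewrite mulr_ge0.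
rewrite -!mulrA; set x := (14 * m)%:R * rho; set y := n%:R * rho.
rewrite [(14 * m)%:R * (2%:R * rho)]mulrCA -/x; lra.
Qed.

(** * The limit *)

Lemma bernoulli_ineq (R : realFieldType) (x : R) (m : nat) :
  0 <= x -> 1 + m%:R * x <= (1 + x) ^+ m.
Proof.
move=> x0; elim: m => [|m IH]; first by rewrite mul0r addr0 expr0.
rewrite exprS; apply: le_trans (ler_wpM2l _ IH); last by rewrite addr_ge0.
have : 0 <= m%:R * x * x by rewrite !mulr_ge0.
by rewrite -natr1; lra.
Qed.

(** Split [r ^+ m <= s ^+ m * s ^+ m]; by Bernoulli's inequality one factor absorbs [m.+1] at the
    cost of [c^-1]. *)
Lemma linear_mul_pow_le (R : realFieldType) (r s c : R) :
  0 <= r -> 0 < s -> r <= s ^+ 2 -> 0 < c -> (1 + c) * s <= 1 -> c <= 1 ->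
  forall m, m.+1%:R * r ^+ m <= c^-1 * s ^+ m.
Proof.
move=> r0 s0 rs c0 cs c1 m.
have h1 : r ^+ m <= s ^+ m * s ^+ m.
  by rewrite -exprMn -expr2; apply: lerXn2r; rewrite ?nnegrE ?sqr_ge0.
have h2 : (1 + m%:R * c) * s ^+ m <= 1.
  apply: le_trans (_ : ((1 + c) * s) ^+ m <= _).
    by rewrite exprMn ler_wpM2r ?exprn_ge0 ?bernoulli_ineq // ltW.
  by apply: exprn_ile1 => //; rewrite mulr_ge0 ?addr_ge0 // ltW.
apply: le_trans (ler_wpM2l (ler0n _ _) h1) _.
rewrite mulrA ler_wpM2r ?exprn_ge0 ?(ltW s0) // -[leRHS]mulr1 ler_pdivlMl //.
apply: le_trans h2; rewrite mulrA ler_wpM2r ?exprn_ge0 ?(ltW s0) //.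
by rewrite -natr1; lra.
Qed.

(** For [t = m %/ 64] one has [3 * m <= 192 * t.+1], so this supplies the hypothesis
    [3 * m <= 2 ^ t]. *)
Lemma linear_le_pow2 (t : nat) : (12 <= t)%N -> (192 * t.+1 <= 2 ^ t)%N.
Proof.
move=> t12; rewrite -(subnK t12); elim: (t - 12)%N => [|u IH]; first by lia.
by rewrite addSn expnS; lia.
Qed.

Lemma prob_GnhalfE (R : realType) (n : nat) (P : {set {set 'I_n}} -> Prop) :
  prob_Gnhalf R P = mean (pairs n) (fun E => (`[< P E >])%:R).
Proof.
rewrite /prob_Gnhalf /mean; congr (_ / _).
rewrite -sum1_card natr_sum [RHS]big_mkcond [LHS]big_mkcond /=; apply: eq_bigr => E _.
by rewrite inE; case: (E \in _) => //=; case: asboolP.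
Qed.

Lemma prob_Gnhalf_le1 (R : realType) (n : nat) (P : {set {set 'I_n}} -> Prop) :
  prob_Gnhalf R P <= 1.
Proof.
rewrite prob_GnhalfE -[leRHS](mean_cst (pairs n)); apply: mean_le => E _.
by case: asboolP.
Qed.

Lemma prob_d_rigid_ge (R : realType) (n m t d : nat) :
  (32 * m <= n)%N -> (64 * t <= m)%N -> (64 <= m)%N -> (3 * m <= 2 ^ t)%N -> (d <= 7 * m)%N ->
  1 - 4%:R * n%:R * (999%:R / 1000%:R) ^+ m <= prob_Gnhalf R (fun E => @d_rigid R n d E).
Proof.
move=> n32 tm m64 m3 d7.
have hk : (2 * (14 * m) <= n)%N by lia.
rewrite lerBlDl; apply: le_trans (_ : mean (pairs n) (fun E => (~~ good_graph hk E)%:R) +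
   prob_Gnhalf R (fun E => @d_rigid R n d E) <= _); last first.
  by rewrite lerD2r; apply: good_graph_tail => //; lia.
rewrite prob_GnhalfE -meanD -[leLHS](mean_cst (pairs n)); apply: mean_le => E _.
case: (boolP (good_graph hk E)) => [/and3P[g1 g2 g3]|_] /=; last by rewrite lerDl.
have [q rq] := @exists_inf_rigid R n m t d hk E tm m64 m3 d7 g1 g2 g3.
by rewrite asboolT ?add0r //; exact: inf_rigid_d_rigid rq.
Qed.

(** Rounding [n] down to a multiple of 32 costs at most [7 * 31 / 32 < 7], while the subtracted term
    is at least [112 / 16 = 7], because [15 * 1000 >= 112 ^ 2] and the logarithm is at least 1. *)
Lemma dn_le (R : realType) (n : nat) :
  expR 1 <= n%:R :> R -> 1000%:R <= n%:R :> R -> (dn R n <= 7 * (n %/ 32))%N.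
Proof.
move=> ne n1000; rewrite /dn truncn_le_nat.
set m := (n %/ 32)%N.
have nm : n%:R <= 32%:R * m%:R + 31%:R :> R.
  by rewrite -natrM -natrD ler_nat /m; lia.
have ln1 : 1 <= ln (n%:R : R).
  by rewrite -[leLHS]expRK ler_ln // posrE ?expR_gt0 // (lt_le_trans _ ne) ?expR_gt0.
have s112 : 112%:R <= Num.sqrt (15%:R * n%:R * ln (n%:R : R)).
  rewrite -[leLHS]ger0_norm ?ler0n // -sqrtr_sqr ler_wsqrtr //.
  have : 15%:R * n%:R * 1 <= 15%:R * n%:R * ln (n%:R : R) by rewrite ler_wpM2l // mulr_ge0.
  by rewrite expr2; lra.
have -> : (7 * m).+1%:R = 7%:R * m%:R + 1 :> R by rewrite -natr1 natrM.
lra.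
Qed.

Theorem theorem1p5 (R : realType) :
  ((fun n : nat => @prob_Gnhalf R n (fun E => @d_rigid R n (dn R n) E)) @ \oo --> (1 : R))%classic.
Proof.
(* Chosen so that [s ^+ 2 >= 999/1000] and [(1 + c) * s <= 1]. *)
pose s : R := 1999%:R / 2000%:R; pose c : R := 3000%:R^-1.
have s0 : 0 < s by rewrite /s; lra.
have s1 : `|s| < 1 by rewrite ger0_norm ?(ltW s0) // /s; lra.
have pow m : m.+1%:R * (999%:R / 1000%:R) ^+ m <= c^-1 * s ^+ m.
  by apply: linear_mul_pow_le; rewrite /s /c ?expr2; lra.
(* The constant 128 is [4 * 32], from [n <= 32 * (n %/ 32).+1]. *)
have lim1 : (1 - geometric (128%:R * c^-1) s (n %/ 32)%N @[n --> \oo] --> (1 : R))%classic.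
  rewrite -[X in (_ --> X)%classic]subr0; apply: cvgB; first exact: cvg_cst.
  exact: (cvg_comp _ _ (@cvg_divnr 32 isT) (cvg_geometric (128%:R * c^-1) s1)).
apply: (squeeze_cvgr _ lim1 (cvg_cst _)).
near=> n; rewrite prob_Gnhalf_le1 andbT.
(* As [768 = 64 * 12], this makes [t = n %/ 32 %/ 64] at least 12. *)
have n25 : (32 * 768 <= n)%N by near: n; exact: nbhs_infty_ge.
have t12 : (12 <= n %/ 32 %/ 64)%N by lia.
apply: le_trans (@prob_d_rigid_ge R n (n %/ 32) (n %/ 32 %/ 64) (dn R n) _ _ _ _ _); try lia.
- rewrite lerB // /geometric /= -!mulrA.
  apply: le_trans (_ : 4%:R * ((32 * (n %/ 32).+1)%:R * (999%:R / 1000%:R) ^+ (n %/ 32)) <= _).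
    rewrite ler_wpM2l // ler_wpM2r ?ler_nat; [by []| |by lia].
    by apply: exprn_ge0; lra.
  rewrite natrM -mulrA; have := pow (n %/ 32)%N; lra.
- have := linear_le_pow2 t12; apply: leq_trans; lia.
apply: dn_le; near: n; exact: nbhs_infty_ger.
Unshelve. all: by end_near.
Qed.
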